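(* Let $\Lambda$ be a finite set of sites and $N\ge2$. For each unordered pair $\langle xy\rangle$ of distinct sites let $J'_{xy}\in\mathbb{R}$ and $J_{xy}\in\mathbb{R}$ with $|J'_{xy}|\le J_{xy}$. Let $\langle\cdot\rangle_{N,J'}$ be expectation in the $N$-vector model: spins $\sigma_x\in S^{N-1}\subset\mathbb{R}^N$, Boltzmann–Gibbs measure proportional to $e^{\sum_{\langle xy\rangle}J'_{xy}\sigma_x\cdot\sigma_y}\prod_x d\Omega(\sigma_x)$ with $d\Omega$ the uniform measure on $S^{N-1}$. Let $\langle\cdot\rangle_{XY,J}$ be expectation in the $XY$ model: angles $\theta_x\in[0,2\pi)$, measure proportional to $e^{\sum_{\langle xy\rangle}J_{xy}\cos(\theta_x-\theta_y)}\prod_x d\theta_x$. Then for all $x,y\in\Lambda$, $$|\langle\sigma_x\cdot\sigma_y\rangle_{N,J'}|\le\langle\cos(\theta_x-\theta_y)\rangle_{XY,J},$$ and, writing $\gamma_{xy}=\langle\cos2(\theta_x-\theta_y)\rangle_{XY,J}$, $$0\le\langle(\sigma_x\cdot\sigma_y)^2\rangle_{N,J'}\le\frac1N+\frac{(N-1)(N+2)}{N\,[2N-(N-2)\gamma_{xy}]}\gamma_{xy}\le\frac1N+\Big(1-\frac1N\Big)\gamma_{xy}.$$ *)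

(* Defs.v *)
From HB Require Import structures.
From mathcomp Require Import all_boot all_order all_algebra.
From mathcomp Require Import all_classical all_reals all_analysis.
Set Implicit Arguments. Unset Strict Implicit. Unset Printing Implicit Defensive.
Import Order.TTheory GRing.Theory Num.Theory.
Local Open Scope classical_set_scope.
Local Open Scope ring_scope.

Section Models.
Variable R : realType.

Fixpoint iint (I : eqType) (D : set R) (s : seq I) (f : (I -> R) -> R) : R :=
  match s with
  | [::] => f (fun _ => 0)
  | i :: s' => Rintegral lebesgue_measure D
      (fun t => iint D s' (fun v => f (fun j => if j == i then t else v j)))
  end.

Variable L : finType.

Definition dotp (N : nat) (a b : 'I_N -> R) : R := \sum_(i < N) a i * b i.

(* Hamiltonian  sum over unordered pairs <xy>, x <> y, of J_xy s_x.s_y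
   (J symmetric, so half the ordered sum) *)
Definition energyN (N : nat) (J : L -> L -> R) (s : L -> 'I_N -> R) : R :=
  2^-1 * \sum_(x : L) \sum_(y : L | y != x) J x y * dotp (s x) (s y).

Definition normalize (N : nat) (v : L * 'I_N -> R) : L -> 'I_N -> R :=
  fun x i => v (x, i) / Num.sqrt (\sum_(j < N) v (x, j) ^+ 2).

Definition inball (N : nat) (v : L * 'I_N -> R) : R :=
  \prod_(x : L) (if \sum_(j < N) v (x, j) ^+ 2 <= 1 then 1 else 0).

(* Gibbs expectation of f in the N-vector model with couplings J.  The
   uniform (normalized surface) measure on S^{N-1} is realized as the cone
   measure: the push-forward of normalized Lebesgue measure on the unit ball
   under v |-> v/|v|; the normalizing constants cancel in the ratio. *)
Definition gibbsN (N : nat) (J : L -> L -> R) (f : (L -> 'I_N -> R) -> R) : R :=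
  iint `[-1, 1] (enum {: L * 'I_N})
       (fun v => inball v * expR (energyN J (normalize v)) * f (normalize v))
  / iint `[-1, 1] (enum {: L * 'I_N})
       (fun v => inball v * expR (energyN J (normalize v))).

Definition energyXY (J : L -> L -> R) (th : L -> R) : R :=
  2^-1 * \sum_(x : L) \sum_(y : L | y != x) J x y * cos (th x - th y).

Definition gibbsXY (J : L -> L -> R) (g : (L -> R) -> R) : R :=
  iint `[0, 2 * pi[ (enum L) (fun th => expR (energyXY J th) * g th)
  / iint `[0, 2 * pi[ (enum L) (fun th => expR (energyXY J th)).

End Models.

(* Main.v *)
Require Import Defs.
From HB Require Import structures.
From mathcomp Require Import all_boot all_order all_algebra.
From mathcomp Require Import all_classical all_reals all_analysis.
From mathcomp Require Import measurable_realfun lebesgue_integral_fubini.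
From mathcomp Require Import ring lra.
Set Implicit Arguments. Unset Strict Implicit. Unset Printing Implicit Defensive.
Import Order.TTheory GRing.Theory Num.Theory.
Import numFieldNormedType.Exports.
Local Open Scope classical_set_scope.
Local Open Scope ring_scope.

(** Fix two coordinates i <> j and rotate the spin at each site x by an
    independent angle in the plane (i, j); the a priori measure is invariant.
    Given the lengths r_x <= 1 of the projections of the spins to that plane,
    the angles form an XY model with couplings J'_xy r_x r_y, which are bounded by
    J_xy in absolute value, so Ginibre's inequality bounds the expectation of
    (r_x r_y)^m cos m(theta_x - theta_y) by that of (r_x r_y)^m times
    <cos m(theta_x - theta_y)>_{XY,J}.  Summing over all ordered pairs (i, j) gives
    the first bound from m = 1 and r_x r_y <= (r_x^2 + r_y^2) / 2.  For m = 2 the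
    sum involves (s_x.s_y)^2 and S = sum_k s_xk^2 s_yk^2; rotating all spins by
    pi/4 gives (N + 2) <S> = 1 + 2 <(s_x.s_y)^2>, which eliminates S.

    Ginibre's inequality for signed couplings |K| <= J: in the duplicated system
    with angles u - v and u + v, cos + cos and cos - cos are the positive
    semidefinite kernels 2 cos cos and 2 sin sin, and such kernels are stable under
    sums, products and exponentials. *)

(** Angles enter by averaging over all rotations of the plane (i, j), not by a change to polar
    coordinates: no Jacobian appears, and for each frozen vector [v] the average is an XY integral.
    Its effective couplings vary with [v], but the factor in Ginibre's bound is a correlation for
    the couplings J, the same for every [v]; this is why the bound can be integrated over [v]. No
    symmetry is free, because the integrals are iterated over a cube and over half-open intervals.
    Rotations preserve a cube integral only for integrands supported in the unit disk of the plane.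
    The map (u, v) to (u - v, u + v) leaves the fundamental domain of the torus, and its inverse
    would halve angles, which is ambiguous there. For m = 2 the sum over planes is not expressed by
    the inner product alone: S is not invariant under rotations, so a second relation is needed.
    With g the XY correlation, A the integral of (s_x.s_y)^2 and Z the total weight, eliminating S
    gives A (2 N - (N - 2) g) <= (2 + N g) Z, which is the stated bound in another form. *)

Section BoundedMeasurable.
Variable R : realType.

(** Boundedness is required on the whole space: on domains of finite measure this gives
    integrability, and it is stable under composition, products and partial integration without
    further side conditions. *)
Definition bm d (T : measurableType d) (f : T -> R) :=
  measurable_fun setT f /\ exists M, forall t, `|f t| <= M.

Section closure.
Variables (d : measure_display) (T : measurableType d).
Implicit Types f g : T -> R.

Lemma eq_bm f g : f =1 g -> bm f -> bm g.
Proof. by move=> /funext ->. Qed.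

Lemma bm_cst (c : R) : bm (fun _ : T => c).
Proof. by split; [exact: measurable_cst | exists `|c|]. Qed.

Lemma bmD f g : bm f -> bm g -> bm (fun t => f t + g t).
Proof.
move=> [mf [M hM]] [mg [K hK]]; split; first exact: measurable_funD.
by exists (M + K) => t; rewrite (le_trans (ler_normD _ _))// lerD.
Qed.

Lemma bmN f : bm f -> bm (fun t => - f t).
Proof.
move=> [mf [M hM]]; split; first exact: measurable_funN.
by exists M => t; rewrite normrN.
Qed.

Lemma bmB f g : bm f -> bm g -> bm (fun t => f t - g t).
Proof. by move=> bf bg; apply: bmD => //; exact: bmN. Qed.

Lemma bmM f g : bm f -> bm g -> bm (fun t => f t * g t).
Proof.
move=> [mf [M hM]] [mg [K hK]]; split; first exact: measurable_funM.
by exists (M * K) => t; rewrite normrM ler_pM.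
Qed.

Lemma bmZ (c : R) f : bm f -> bm (fun t => c * f t).
Proof. by move=> bf; apply: bmM => //; exact: bm_cst. Qed.

Lemma bmX f n : bm f -> bm (fun t => f t ^+ n).
Proof.
move=> bf; elim: n => [|n IH]; first exact: (eq_bm _ (bm_cst 1)).
by apply: (eq_bm _ (bmM bf IH)) => t; rewrite exprS.
Qed.

Lemma bm_sum (K : Type) (s : seq K) (P : pred K) (F : K -> T -> R) :
  (forall k, P k -> bm (F k)) -> bm (fun t => \sum_(k <- s | P k) F k t).
Proof.
move=> hF; elim: s => [|k s IH].
  by apply: (eq_bm _ (bm_cst 0)) => t; rewrite big_nil.
have [Pk|Pk] := boolP (P k).
  by apply: (eq_bm _ (bmD (hF _ Pk) IH)) => t; rewrite big_cons Pk.
by apply: (eq_bm _ IH) => t; rewrite big_cons (negbTE Pk).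
Qed.

Lemma bm_prod (K : Type) (s : seq K) (P : pred K) (F : K -> T -> R) :
  (forall k, P k -> bm (F k)) -> bm (fun t => \prod_(k <- s | P k) F k t).
Proof.
move=> hF; elim: s => [|k s IH].
  by apply: (eq_bm _ (bm_cst 1)) => t; rewrite big_nil.
have [Pk|Pk] := boolP (P k).
  by apply: (eq_bm _ (bmM (hF _ Pk) IH)) => t; rewrite big_cons Pk.
by apply: (eq_bm _ IH) => t; rewrite big_cons (negbTE Pk).
Qed.

Lemma bm_expR f : bm f -> bm (fun t => expR (f t)).
Proof.
move=> [mf [M hM]]; split; first exact: measurableT_comp (@measurable_expR R) mf.
by exists (expR M) => t; rewrite ger0_norm ?expR_ge0// ler_expR (le_trans _ (hM t)) ?ler_norm.
Qed.

Lemma bm_cos f : measurable_fun setT f -> bm (fun t => cos (f t)).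
Proof.
move=> mf; split.
  apply: measurableT_comp mf; apply: continuous_measurable_fun; exact: continuous_cos.
by exists 1 => t; rewrite ler_norml cos_geN1 cos_le1.
Qed.

Lemma bm_sin f : measurable_fun setT f -> bm (fun t => sin (f t)).
Proof.
move=> mf; split.
  apply: measurableT_comp mf; apply: continuous_measurable_fun; exact: continuous_sin.
by exists 1 => t; rewrite ler_norml sin_geN1 sin_le1.
Qed.

Lemma bm_if (b : T -> bool) f g : measurable_fun setT b -> bm f -> bm g ->
  bm (fun t => if b t then f t else g t).
Proof.
move=> mb [mf [M hM]] [mg [K hK]]; split; first exact: measurable_fun_ifT.
exists (Num.max M K) => t; rewrite le_max.
by case: (b t); rewrite ?hM ?hK ?orbT.
Qed.

End closure.

Lemma bm_comp d d' (T : measurableType d) (T' : measurableType d')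
  (f : T' -> R) (u : T -> T') : measurable_fun setT u -> bm f -> bm (fun t => f (u t)).
Proof.
move=> mu [mf [M hM]]; split; first exact: measurableT_comp mf mu.
by exists M => t.
Qed.

Notation lam := (@lebesgue_measure R).

Definition fdom (D : set R) :=
  measurable (D : set (measurableTypeR R)) /\ (lam D < +oo)%E.

Section bounded_integral.
Variables (D : set R) (hD : fdom D).
Let mD := hD.1.
Let fD := hD.2.

Lemma bm_integrable (f : measurableTypeR R -> R) : bm f -> lam.-integrable D (EFin \o f).
Proof.
move=> [mf [M hM]]; apply: measurable_bounded_integrable => //.
  exact: measurable_funS mf.
by exists M; split; [exact: num_real|move=> x Mx t _ /=; exact: le_trans (hM t) (ltW Mx)].
Qed.

Lemma measurable_Rint d (T : measurableType d) (f : T * measurableTypeR R -> R) :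
  bm f -> measurable_fun setT (fun t => Rintegral lam D (fun r => f (t, r))).
Proof.
move=> bf; have [mf [M hM]] := bf.
have M0 : 0 <= M by apply: le_trans (hM point); exact: normr_ge0.
(* Adding the bound [M] makes the integrand nonnegative, and cutting it off outside [D] extends the
   integral to the whole line, so that Tonelli's theorem gives measurability; [M] times the length
   of [D] is subtracted afterwards. *)
pose g p := if p.2 \in D then f p + M else 0.
have g0 p : 0 <= g p.
  rewrite /g; case: ifP => // _; rewrite -lerBlDr sub0r.
  by have := hM p; rewrite ler_norml => /andP[].
have mg : measurable_fun setT g.
  apply: measurable_fun_ifT => //.
    apply: (@measurableT_comp _ _ _ _ _ _ (fun r => r \in D)) => //.
    apply: (measurable_fun_bool true); rewrite setTI.
    by rewrite [X in measurable X](_ : _ = D)//; apply/seteqP; split => x /= xD;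
      [exact: set_mem | exact: mem_set].
  by apply: measurable_funD => //; exact: measurable_cst.
have -> : (fun t => Rintegral lam D (fun r => f (t, r))) =
    (fun t => fine (\int[lam]_r (g (t, r))%:E)%E - M * fine (lam D)).
  apply/funext => t.
  have bft : bm (fun r : measurableTypeR R => f (t, r)).
    by apply: (bm_comp (u := fun r => (t, r))) => //; exact: pair1_measurable.
  have -> : fine (\int[lam]_r (g (t, r))%:E)%E = Rintegral lam D (fun r => f (t, r) + M).
    rewrite Rintegral_mkcond /Rintegral; congr fine; apply: eq_integral => r _.
  rewrite RintegralD ?Rintegral_cst//; [ring|exact: bm_integrable|].
  exact: (bm_integrable (bm_cst _ _)).
apply: measurable_funB; last exact: measurable_cst.
apply: measurableT_comp; first exact: fine_measurable.
apply: (@measurable_fun_fubini_tonelli_F _ _ T (measurableTypeR R) R lam (EFin \o g)).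
  exact/measurable_EFinP.
by move=> p; rewrite lee_fin.
Qed.

Lemma Rint_bound (f : measurableTypeR R -> R) M : bm f -> (forall t, `|f t| <= M) ->
  `|Rintegral lam D f| <= M * fine (lam D).
Proof.
move=> bf hM; rewrite (le_trans (le_normr_Rintegral _ (bm_integrable bf)))//.
rewrite -Rintegral_cst//; apply: le_Rintegral => //.
- by apply: integrable_norm; exact: bm_integrable.
- exact: (bm_integrable (bm_cst _ _)).
Qed.

Lemma bm_Rint d (T : measurableType d) (f : T * measurableTypeR R -> R) :
  bm f -> bm (fun t => Rintegral lam D (fun r => f (t, r))).
Proof.
move=> bf; split; first exact: measurable_Rint.
have [mf [M hM]] := bf; exists (M * fine (lam D)) => t.
apply: Rint_bound => //; apply: (bm_comp (u := fun r => (t, r))) => //.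
exact: pair1_measurable.
Qed.

End bounded_integral.

Section fubini.
Variables (D E : set R) (hD : fdom D) (hE : fdom E).
Let mD := hD.1.
Let mE := hE.1.
Let fD := hD.2.
Let fE := hE.2.

Lemma bm_integrable2 (f : measurableTypeR R * measurableTypeR R -> R) :
  bm f -> (lam \x lam)%E.-integrable (D `*` E) (EFin \o f).
Proof.
move=> [mf [M hM]]; apply: measurable_bounded_integrable => //.
- exact: measurableX.
- apply: (@eq_ind_r _ _ (fun z => (z < +oo)%E) _ _ (product_measure1E lam lam mD mE)).
  by rewrite lte_mul_pinfty// ge0_fin_numE.
- exact: measurable_funS mf.
- by exists M; split; [exact: num_real|move=> x Mx t _ /=; exact: le_trans (hM t) (ltW Mx)].
Qed.

Lemma Rint_fubini (f : measurableTypeR R * measurableTypeR R -> R) : bm f ->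
  Rintegral lam D (fun x => Rintegral lam E (fun y => f (x, y))) =
  Rintegral (lam \x lam)%E (D `*` E) f.
Proof.
move=> bf; have [mf [M hM]] := bf.
have mDD : measurable (D `*` E : set (measurableTypeR R * measurableTypeR R)) by exact: measurableX.
have ig : (lam \x lam)%E.-integrable setT (EFin \o (f \_ (D `*` E))).
  have := (integrable_mkcond (EFin \o f) mDD).1 (bm_integrable2 bf).
  by apply: eq_integrable => // p _; rewrite restrict_EFin.
rewrite [RHS]Rintegral_mkcond /Rintegral -integral12_prod_meas1//; congr fine.
rewrite [LHS]integral_mkcond; apply: eq_integral => x _; rewrite /fubini_F patchE.
have [xD|xD] := boolP (x \in D); last first.
  rewrite integral0_eq// => y _; rewrite patchE ifF//.
  by apply/negbTE; apply: contra xD; rewrite !inE => -[].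
have bfx : bm (fun y : measurableTypeR R => f (x, y)).
  by apply: (bm_comp (u := fun r => (x, r))) => //; exact: pair1_measurable.
rewrite fineK; last by apply: integrable_fin_num => //; exact: (bm_integrable hE).
rewrite [LHS]integral_mkcond; apply: eq_integral => y _; rewrite !patchE.
rewrite (_ : ((x, y) \in D `*` E) = (y \in E)); first by case: ifP.
by apply/idP/idP => [/set_mem[]/= _ /mem_set//|/set_mem yD]; apply/mem_set; split => //; exact: set_mem.
Qed.

Lemma Rint_fubini2 (f : measurableTypeR R * measurableTypeR R -> R) : bm f ->
  Rintegral lam E (fun y => Rintegral lam D (fun x => f (x, y))) =
  Rintegral (lam \x lam)%E (D `*` E) f.
Proof.
move=> bf; have [mf [M hM]] := bf.
have mDD : measurable (D `*` E : set (measurableTypeR R * measurableTypeR R)) by exact: measurableX.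
have ig : (lam \x lam)%E.-integrable setT (EFin \o (f \_ (D `*` E))).
  have := (integrable_mkcond (EFin \o f) mDD).1 (bm_integrable2 bf).
  by apply: eq_integrable => // p _; rewrite restrict_EFin.
rewrite [RHS]Rintegral_mkcond /Rintegral -integral21_prod_meas1//; congr fine.
rewrite [LHS]integral_mkcond; apply: eq_integral => y _; rewrite /fubini_G patchE.
have [yD|yD] := boolP (y \in E); last first.
  rewrite integral0_eq// => x _; rewrite patchE ifF//.
  by apply/negbTE; apply: contra yD; rewrite !inE => -[].
have bfy : bm (fun x : measurableTypeR R => f (x, y)).
  by apply: (bm_comp (u := fun r => (r, y))) => //; exact: pair2_measurable.
rewrite fineK; last by apply: integrable_fin_num => //; exact: (bm_integrable hD).
rewrite [LHS]integral_mkcond; apply: eq_integral => x _; rewrite !patchE.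
rewrite (_ : ((x, y) \in D `*` E) = (x \in D)); first by case: ifP.
by apply/idP/idP => [/set_mem[]/= /mem_set//|/set_mem xD]; apply/mem_set; split => //; exact: set_mem.
Qed.

Lemma Rint_swap (f : measurableTypeR R * measurableTypeR R -> R) : bm f ->
  Rintegral lam D (fun x => Rintegral lam E (fun y => f (x, y))) =
  Rintegral lam E (fun y => Rintegral lam D (fun x => f (x, y))).
Proof. by move=> bf; rewrite Rint_fubini// Rint_fubini2. Qed.

End fubini.
End BoundedMeasurable.
Notation lam := (@lebesgue_measure _).

(** * Configuration spaces and iterated integrals *)

Section Configurations.
Variables (R : realType) (I : eqType).

(** Generators of the product sigma-algebra, for which a map into configurations is measurable as
    soon as its coordinates are. *)
Definition cylinders : set (set (I -> R)) :=
  \bigcup_(i in [set: I]) preimage_set_system setT (fun v : I -> R => v i) measurable.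

Definition cfg := g_sigma_algebraType cylinders.

Lemma measurable_coord (i : I) : measurable_fun setT (fun v : cfg => v i).
Proof.
move=> _ A mA; apply: sub_sigma_algebra; exists i => //.
by exists A.
Qed.

Lemma measurable_cfg d (T : measurableType d) (u : T -> cfg) :
  (forall i, measurable_fun setT (fun t => u t i)) -> measurable_fun setT u.
Proof.
move=> mu; apply: (@measurability _ _ T cfg setT u cylinders) => //.
move=> _ [_ [i _ [A mA <-]] <-]; rewrite !setTI.
by have := mu i measurableT A mA; rewrite setTI.
Qed.

Lemma measurable_cfg_coord d (T : measurableType d) (u : T -> cfg) i :
  measurable_fun setT u -> measurable_fun setT (fun t => u t i).
Proof. by move=> mu; exact: (measurableT_comp (measurable_coord i) mu). Qed.

(** Same shape as the substitution inside [iint], so that [iint_cons] holds by conversion. *)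
Definition upd (i : I) (r : R) (v : cfg) : cfg := fun j => if j == i then r else v j.

Lemma measurable_upd d (T : measurableType d) i (r : T -> R) (u : T -> cfg) :
  measurable_fun setT r -> measurable_fun setT u -> measurable_fun setT (fun t => upd i (r t) (u t)).
Proof.
move=> mr mu; apply: measurable_cfg => j; rewrite /upd.
by case: eqP => // _; exact: measurable_cfg_coord.
Qed.

Lemma updC i j r r' v : i != j -> upd i r (upd j r' v) = upd j r' (upd i r v).
Proof.
move=> ij; apply/funext => k; rewrite /upd.
by have [->|//] := eqVneq k i; rewrite (negbTE ij).
Qed.

Section iint.
Variables (D : set R) (hD : fdom D).
Implicit Types f g : cfg -> R.

Lemma iint_cons i s f :
  iint D (i :: s) f = Rintegral lam D (fun r => iint D s (fun v => f (upd i r v))).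
Proof. by []. Qed.

Lemma bm_upd f i r : bm f -> bm (fun v => f (upd i r v)).
Proof.
move=> bf; apply: (bm_comp _ bf).
by apply: measurable_upd; [exact: measurable_cst | exact: measurable_id].
Qed.

(** The parameter space [T] is arbitrary because the induction on [s] moves the coordinate just
    removed into the parameter. *)
Lemma bm_iint s d (T : measurableType d) (F : T * cfg -> R) :
  bm F -> bm (fun t => iint D s (fun v => F (t, v))).
Proof.
elim: s d T F => [|i s IH] d T F bF.
  by apply: (bm_comp _ bF); exact: pair2_measurable.
apply: (bm_Rint hD (f := fun p => iint D s (fun v => F (p.1, upd i p.2 v)))).
pose G (q : (T * measurableTypeR R) * cfg) := F (q.1.1, upd i q.1.2 q.2).
apply: (IH _ _ G); apply: (bm_comp _ bF).
apply: measurable_fun_pair; first exact: measurableT_comp.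
by apply: measurable_upd => //; exact: measurableT_comp.
Qed.

Lemma bm_iint_upd i s f : bm f ->
  bm (fun r : measurableTypeR R => iint D s (fun v => f (upd i r v))).
Proof.
move=> bf; apply: (bm_iint _ (F := fun p => f (upd i p.1 p.2))).
by apply: (bm_comp _ bf); exact: measurable_upd.
Qed.

Lemma iintD s f g : bm f -> bm g ->
  iint D s (fun v => f v + g v) = iint D s f + iint D s g.
Proof.
elim: s f g => [//|i s IH] f g bf bg.
rewrite !iint_cons -RintegralD; last 3 first.
- exact: hD.1.
- by apply: bm_integrable => //; exact: bm_iint_upd.
- by apply: bm_integrable => //; exact: bm_iint_upd.
by apply: eq_Rintegral => r _; rewrite IH//; exact: bm_upd.
Qed.

Lemma iintZ s (c : R) f : bm f -> iint D s (fun v => c * f v) = c * iint D s f.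
Proof.
elim: s f => [//|i s IH] f bf.
rewrite !iint_cons -RintegralZl; last 2 first.
- exact: hD.1.
- by apply: bm_integrable => //; exact: bm_iint_upd.
by apply: eq_Rintegral => r _; rewrite IH//; exact: bm_upd.
Qed.

Lemma iint_cst s (c : R) : iint D s (fun _ : I -> R => c) = c * fine (lam D) ^+ size s.
Proof.
elim: s => [|i s IH]; first by rewrite mulr1.
by rewrite iint_cons IH Rintegral_cst ?exprSr ?mulrA//; exact: hD.1.
Qed.

Lemma le_iint s f g : bm f -> bm g -> (forall v, f v <= g v) -> iint D s f <= iint D s g.
Proof.
elim: s f g => [|i s IH] f g bf bg fg; first exact: fg.
rewrite !iint_cons; apply: le_Rintegral.
- exact: hD.1.
- by apply: bm_integrable => //; exact: bm_iint_upd.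
- by apply: bm_integrable => //; exact: bm_iint_upd.
by move=> r _; apply: IH => [||v]; [exact: bm_upd|exact: bm_upd|exact: fg].
Qed.

Lemma iintB s f g : bm f -> bm g ->
  iint D s (fun v => f v - g v) = iint D s f - iint D s g.
Proof.
move=> bf bg; rewrite iintD//; last exact: bmN.
congr (_ + _); rewrite -mulN1r -iintZ//; congr iint; apply/funext => v.
by rewrite mulN1r.
Qed.

Lemma iint_sum (K : Type) (l : seq K) (P : pred K) s (F : K -> cfg -> R) :
  (forall k, bm (F k)) ->
  iint D s (fun v => \sum_(k <- l | P k) F k v) = \sum_(k <- l | P k) iint D s (F k).
Proof.
move=> bF; elim: l => [|k l IH].
  rewrite big_nil -[RHS](mul0r (fine (lam D) ^+ size s)) -iint_cst; congr iint.
  by apply/funext => v; rewrite big_nil.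
rewrite big_cons -IH; case: ifP => Pk.
  rewrite -iintD//; last by apply: bm_sum.
  by congr iint; apply/funext => v; rewrite big_cons Pk.
by congr iint; apply/funext => v; rewrite big_cons Pk.
Qed.

End iint.

Lemma iint_Rint_swap (D E : set R) s (F : measurableTypeR R * cfg -> R) :
  fdom D -> fdom E -> bm F ->
  Rintegral lam E (fun r => iint D s (fun v => F (r, v))) =
  iint D s (fun v => Rintegral lam E (fun r => F (r, v))).
Proof.
move=> hD hE; elim: s F => [//|i s IH] F bF.
rewrite iint_cons.
pose H (q : (measurableTypeR R * measurableTypeR R) * cfg) := F (q.1.1, upd i q.1.2 q.2).
have bH : bm H.
  apply: (bm_comp _ bF).
  apply: measurable_fun_pair; first exact: measurableT_comp.
  by apply: measurable_upd => //; exact: measurableT_comp.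
rewrite (Rint_swap hE hD (f := fun p => iint D s (fun v => F (p.1, upd i p.2 v)))); last first.
  exact: (bm_iint hD s bH).
apply: eq_Rintegral => r _ /=.
rewrite (IH (fun p => F (p.1, upd i r p.2)))//.
apply: (bm_comp _ bF); apply: measurable_fun_pair => //.
exact: measurable_upd.
Qed.

Lemma iint_swap2 (D : set R) (i j : I) s (f : cfg -> R) : fdom D -> i != j -> bm f ->
  iint D [:: i, j & s] f = iint D [:: j, i & s] f.
Proof.
move=> hD ij bf; rewrite !iint_cons.
under eq_Rintegral do rewrite iint_cons.
rewrite (Rint_swap hD hD (f := fun p => iint D s (fun v => f (upd i p.1 (upd j p.2 v))))).
  apply: eq_Rintegral => r _; rewrite iint_cons; apply: eq_Rintegral => r' _ /=.
  by congr iint; apply/funext => v; rewrite updC.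
pose H (q : (measurableTypeR R * measurableTypeR R) * cfg) := f (upd i q.1.1 (upd j q.1.2 q.2)).
apply: (bm_iint hD s (F := H)); apply: (bm_comp _ bf).
apply: measurable_upd; first exact: measurableT_comp.
by apply: measurable_upd => //; exact: measurableT_comp.
Qed.

(** Lets the two coordinates of a plane become the outermost integrations, where invariance under
    planar rotations applies. *)
Lemma iint_to_front (D : set R) (i : I) s (f : cfg -> R) : fdom D -> uniq s -> i \in s -> bm f ->
  iint D s f = iint D (i :: rem i s) f.
Proof.
move=> hD; elim: s f => [//|j s IH] f /andP[js us]; rewrite inE.
have [->|ij] := eqVneq i j => [_ _|is_ bf]; first by rewrite /= eqxx.
have -> : rem i (j :: s) = j :: rem i s by rewrite /= eq_sym (negbTE ij).
rewrite -iint_swap2 1?eq_sym// !iint_cons; apply: eq_Rintegral => r _.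
by rewrite IH//; exact: bm_upd.
Qed.

End Configurations.

Lemma iint_swap (R : realType) (I K : eqType) (D E : set R) s t (F : cfg R I * cfg R K -> R) :
  fdom D -> fdom E -> bm F ->
  iint D s (fun u => iint E t (fun v => F (u, v))) =
  iint E t (fun v => iint D s (fun u => F (u, v))).
Proof.
move=> hD hE; elim: s F => [//|i s IH] F bF.
rewrite iint_cons.
transitivity (Rintegral lam D (fun r => iint E t (fun v => iint D s (fun u => F (upd i r u, v))))).
  apply: eq_Rintegral => r _; apply: (IH (fun p => F (upd i r p.1, p.2))).
  apply: (bm_comp _ bF); apply: measurable_fun_pair => //.
  exact: measurable_upd.
rewrite (iint_Rint_swap t (F := fun p => iint D s (fun u => F (upd i p.1 u, p.2))) hE hD)//.
pose H (q : (measurableTypeR R * cfg R K) * cfg R I) := F (upd i q.1.1 q.2, q.1.2).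
apply: (bm_iint hD s (F := H)); apply: (bm_comp _ bF).
apply: measurable_fun_pair; last exact: measurableT_comp.
by apply: measurable_upd => //; exact: measurableT_comp.
Qed.

(** * Invariance properties of Lebesgue measure *)

Section Translation.
Variable R : realType.
Notation mR := (measurableTypeR R).
Implicit Type c : R.

Lemma measurable_shift c : measurable_fun setT (fun x : mR => (x + c : mR)).
Proof. by apply: measurable_funD => //; exact: measurable_cst. Qed.

(** Translation preserves the length of intervals, and Lebesgue measure is determined by its values
    on half-open intervals. *)
Lemma lebesgue_measure_shift c (A : set mR) : measurable A ->
  lam ((fun x : mR => x + c) @^-1` A) = lam A.
Proof.
move=> mA; pose phi : {mfun mR >-> mR} :=
  HB.pack (fun x : mR => (x + c : mR)) (isMeasurableFun.Build _ _ _ _ _ (measurable_shift c)).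
apply/esym; apply: (@lebesgue_measure_unique R (pushforward lam phi)) => // X [[a b] _ <-].
transitivity (lam `]a - c, b - c]%classic); last first.
  congr (lam _).
  by apply/seteqP; split => x /=; rewrite !in_itv/= ltrBlDr lerBrDr.
rewrite !lebesgue_measure_itv/= !lte_fin ltrD2r; case: ifP => // _.
by rewrite -!EFinB; congr EFin; ring.
Qed.

Lemma ge0_integral_shift c (f : mR -> \bar R) : measurable_fun setT f ->
  (forall x, 0 <= f x)%E -> (\int[lam]_x f ((x : mR) + c)%R = \int[lam]_x f x)%E.
Proof.
move=> mf f0.
pose phi : {mfun mR >-> mR} :=
  HB.pack (fun x : mR => (x + c : mR)) (isMeasurableFun.Build _ _ _ _ _ (measurable_shift c)).
rewrite -[LHS](ge0_integral_pushforward (measurable_shift c) lam (D := setT))//.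
by apply: (@eq_measure_integral _ _ _ _ lam (pushforward lam phi)) => A mA _; exact: lebesgue_measure_shift.
Qed.

Lemma integral_shift c (f : mR -> \bar R) : measurable_fun setT f ->
  (\int[lam]_x f ((x : mR) + c)%R = \int[lam]_x f x)%E.
Proof.
move=> mf; rewrite integralE [RHS]integralE; congr (_ - _)%E.
  by rewrite -[RHS](@ge0_integral_shift c f^\+%E); [apply: eq_integral => x _; rewrite !funeposE|exact: measurable_funepos|by []].
by rewrite -[RHS](@ge0_integral_shift c f^\-%E); [apply: eq_integral => x _; rewrite !funenegE|exact: measurable_funeneg|by []].
Qed.

Lemma Rint_shift_itv c a b (h : mR -> R) : measurable_fun setT h ->
  Rintegral lam `[a, b[ (fun t => h (t + c)) = Rintegral lam `[a + c, b + c[ h.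
Proof.
move=> mh; rewrite Rintegral_mkcond [RHS]Rintegral_mkcond /Rintegral; congr fine.
rewrite -[RHS](integral_shift c); last first.
  apply/measurable_EFinP; apply: (measurable_restrictT _ _).1 => //.
  exact: measurable_funTS.
apply: eq_integral => t _; rewrite !patchE.
by rewrite !mem_setE !in_itv/= lerD2r ltrD2r.
Qed.

Definition circle : set R := `[0, 2 * pi[.

Lemma fdom_circle : fdom circle.
Proof.
split; first exact: measurable_itv.
by rewrite lebesgue_measure_itv/=; case: ifP => // _; rewrite -EFinB ltry.
Qed.

Lemma periodicz (h : R -> R) T (k : int) : periodic h T -> forall t, h (t + k%:~R * T) = h t.
Proof.
move=> hT t; case: k => n; first by rewrite -(periodicn hT n t) mulr_natl.
rewrite NegzE -(periodicn hT n.+1 (t + _)) mulrNz mulNr; congr h.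
by rewrite -mulr_natl; ring.
Qed.

Lemma Rint_circle_shift c (h : mR -> R) : bm h -> periodic h (2 * pi) ->
  Rintegral lam circle (fun t => h (t + c)) = Rintegral lam circle h.
Proof.
move=> bh ph; pose T : R := 2 * pi.
have T0 : 0 < T by rewrite mulr_gt0// pi_gt0.
(* Periodicity replaces [c] by its residue [c'] in [0, T). The shifted period [c', T + c') is cut at
   T, and its end [T, T + c') is carried back to [0, c'). *)
pose k := Num.floor (c / T); pose c' := c - k%:~R * T.
have hc' : 0 <= c' < T.
  have := Num.Theory.floor_itv (c / T); rewrite -/k.
  rewrite ler_pdivlMr// ltr_pdivrMr// intrD mulrDl mul1r /c'.
  by move=> /andP[? ?]; apply/andP; split; lra.
have -> : (fun t => h (t + c)) = (fun t => h (t + c')).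
  apply/funext => t; rewrite -[LHS](periodicz (- k) ph); congr h.
  by rewrite /c' mulrNz -/T; ring.
have [mh _] := bh.
have ih (D : set mR) : measurable D -> (lam D < +oo)%E -> lam.-integrable D (EFin \o h).
  by move=> mD fD; apply: bm_integrable.
have bnd (a b : R) : (lam `[a, b[ < +oo)%E.
  by rewrite lebesgue_measure_itv/=; case: ifP => // _; rewrite -EFinB ltry.
have split3 (a b d : R) : a <= b -> b <= d -> Rintegral lam `[a, d[ h =
    Rintegral lam `[a, b[ h + Rintegral lam `[b, d[ h.
  move=> ab bd; rewrite -Rintegral_setU//=.
  - congr Rintegral; apply/seteqP; split => x /=; rewrite !in_itv/=.
      by move=> /andP[ax xd]; have [xb|xb] := ltP x b; [left; rewrite ax|right].
    by move=> [|] /andP[? ?]; apply/andP; split; lra.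
  - apply: ih; first by apply: measurableU.
    by apply: (@le_lt_trans _ _ (lam `[a, b[ + lam `[b, d[)%E); [exact: measureU2|rewrite lte_add_pinfty].
  - apply/disj_setPS => x [] /=; rewrite !in_itv/= => /andP[_ xb] /andP[bx _].
    by move: (lt_le_trans xb bx); rewrite ltxx.
rewrite Rint_shift_itv// add0r -/T.
case/andP: hc' => c0 cT.
rewrite (split3 c' T (T + c'))//; [|lra|lra].
rewrite [RHS](split3 0 c' T)//; last by lra.
rewrite addrC; congr (_ + _).
transitivity (Rintegral lam `[0, c'[ (fun t => h (t + T))).
  by rewrite Rint_shift_itv// add0r (addrC T).
by apply: eq_Rintegral => t _; rewrite ph.
Qed.

End Translation.

(** * Rotations of the plane *)

Section PlaneRotation.
Variable R : realType.
Notation mR := (measurableTypeR R).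
Notation lam2 := ((@lebesgue_measure R) \x (@lebesgue_measure R))%E.

(** With the second coordinate fixed, a shear is a translation of the first, so Tonelli's theorem
    reduces the claim to the line. *)
Lemma ge0_integral_shear1 (t : R) (F : mR * mR -> \bar R) : measurable_fun setT F ->
  (forall p, 0 <= F p)%E ->
  (\int[lam2]_p F ((p.1 : R) + t * p.2, p.2)%R = \int[lam2]_p F p)%E.
Proof.
move=> mF F0.
have mS : measurable_fun setT (fun p : mR * mR => F ((p.1 : R) + t * p.2, p.2)%R).
  apply: measurableT_comp => //; apply: measurable_fun_pair => //.
  by apply: measurable_funD => //; apply: measurable_funM => //; exact: measurable_cst.
rewrite fubini_tonelli2// [RHS]fubini_tonelli2//; apply: eq_integral => y _.
rewrite /fubini_G /=.
apply: (@ge0_integral_shift R (t * y) (fun x => F (x, y))) => //.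
by apply: measurableT_comp => //; exact: pair2_measurable.
Qed.

Lemma ge0_integral_shear2 (t : R) (F : mR * mR -> \bar R) : measurable_fun setT F ->
  (forall p, 0 <= F p)%E ->
  (\int[lam2]_p F (p.1, (p.2 : R) + t * p.1)%R = \int[lam2]_p F p)%E.
Proof.
move=> mF F0.
have mS : measurable_fun setT (fun p : mR * mR => F (p.1, (p.2 : R) + t * p.1)%R).
  apply: measurableT_comp => //; apply: measurable_fun_pair => //.
  by apply: measurable_funD => //; apply: measurable_funM => //; exact: measurable_cst.
rewrite fubini_tonelli1// [RHS]fubini_tonelli1//; apply: eq_integral => x _.
rewrite /fubini_F /=.
apply: (@ge0_integral_shift R (t * x) (fun y => F (x, y))) => //.
by apply: measurableT_comp => //; exact: pair1_measurable.
Qed.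

Definition rot (c s : R) (p : mR * mR) : mR * mR :=
  ((c * p.1 - s * p.2 : R), (s * p.1 + c * p.2 : R)).

Lemma measurable_rot c s : measurable_fun setT (rot c s).
Proof.
have mM (k : R) (f : mR * mR -> R) :
    measurable_fun setT f -> measurable_fun setT (fun p => k * f p).
  by move=> mf; apply: measurable_funM => //; exact: measurable_cst.
apply: measurable_fun_pair.
  by apply: measurable_funB; apply: mM.
by apply: measurable_funD; apply: mM.
Qed.

(* A rotation other than the half-turn is a product of three shears. *)
Lemma ge0_integral_rot_neqN1 (c s : R) (F : mR * mR -> \bar R) : c ^+ 2 + s ^+ 2 = 1 ->
  c != -1 -> measurable_fun setT F -> (forall p, 0 <= F p)%E ->
  (\int[lam2]_p F (rot c s p) = \int[lam2]_p F p)%E.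
Proof.
(* For c = cos a and s = sin a this is t = - tan (a / 2). The shears are horizontal by [t], vertical
   by [s], horizontal by [t]; their product is the rotation because 1 + t s = c and t (1 + c) = -
   s. *)
move=> cs cN1 mF F0; pose t : R := - s / (1 + c).
have c1 : 1 + c != 0 by rewrite addrC addr_eq0.
have tc : t * (1 + c) = - s by rewrite /t divfK.
have ts : 1 + t * s = c.
  apply: (mulIf c1).
  have -> : (1 + t * s) * (1 + c) = 1 + c + s * (t * (1 + c)) by ring.
  by rewrite tc; lra.
have mD (k : R) : measurable_fun setT (fun p : mR * mR => ((p.1 : R) + k * p.2, p.2)).
  apply: measurable_fun_pair => //.
  by apply: measurable_funD => //; apply: measurable_funM => //; exact: measurable_cst.
have mD2 (k : R) : measurable_fun setT (fun p : mR * mR => (p.1, (p.2 : R) + k * p.1)).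
  apply: measurable_fun_pair => //.
  by apply: measurable_funD => //; apply: measurable_funM => //; exact: measurable_cst.
pose F1 (p : mR * mR) := F ((p.1 : R) + t * p.2, p.2).
pose F2 (p : mR * mR) := F1 (p.1, (p.2 : R) + s * p.1).
have mF1 : measurable_fun setT F1 by exact: measurableT_comp (mD t).
have mF2 : measurable_fun setT F2 by exact: measurableT_comp (mD2 s).
have F10 p : (0 <= F1 p)%E by exact: F0.
have F20 p : (0 <= F2 p)%E by exact: F10.
rewrite -(ge0_integral_shear1 t mF F0) -(ge0_integral_shear2 s mF1 F10).
rewrite -(ge0_integral_shear1 t mF2 F20).
apply: eq_integral => -[x y] _; rewrite /F2 /F1 /rot /=; congr (F (_, _)).
  rewrite -[in LHS]ts; transitivity ((1 + t * s) * x + (t * (1 + t * s + 1)) * y); last by ring.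
  by rewrite ts [c + 1]addrC tc; ring.
by rewrite -[in LHS]ts; ring.
Qed.

Lemma ge0_integral_rot (c s : R) (F : mR * mR -> \bar R) : c ^+ 2 + s ^+ 2 = 1 ->
  measurable_fun setT F -> (forall p, 0 <= F p)%E ->
  (\int[lam2]_p F (rot c s p) = \int[lam2]_p F p)%E.
Proof.
move=> cs mF F0; have [cN1|] := eqVneq c (-1); last by move=> cN1; exact: (ge0_integral_rot_neqN1 cs cN1 mF F0).
have s0 : s = 0.
  by apply/eqP; rewrite -sqrf_eq0; apply/eqP; move: cs; rewrite cN1; lra.
(* The half-turn is the square of the quarter-turn, for which c = 0. *)
have h01 : (0 : R) ^+ 2 + 1 ^+ 2 = 1 by lra.
have n01 : (0 : R) != -1 by rewrite eq_sym oppr_eq0 oner_eq0.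
have mF' : measurable_fun setT (F \o rot 0 1).
  by apply: measurableT_comp => //; exact: measurable_rot.
rewrite -(ge0_integral_rot_neqN1 h01 n01 mF F0).
rewrite -(ge0_integral_rot_neqN1 h01 n01 mF' (fun p => F0 _)).
by apply: eq_integral => -[x y] _; rewrite /rot /= cN1 s0; congr (F (_, _)); ring.
Qed.

Lemma Rintegral_rot (c s : R) (F : mR * mR -> R) : c ^+ 2 + s ^+ 2 = 1 ->
  measurable_fun setT F ->
  Rintegral lam2 setT (fun p => F (rot c s p)) = Rintegral lam2 setT F.
Proof.
move=> cs mF; rewrite /Rintegral; congr fine.
have mEF : measurable_fun setT (EFin \o F) by exact/measurable_EFinP.
rewrite integralE [RHS]integralE; congr (_ - _)%E.
  rewrite -[RHS](ge0_integral_rot (F := (EFin \o F)^\+%E) cs);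
    [apply: eq_integral => x _; rewrite !funeposE|exact: measurable_funepos|by []].
  by [].
rewrite -[RHS](ge0_integral_rot (F := (EFin \o F)^\-%E) cs);
    [apply: eq_integral => x _; rewrite !funenegE|exact: measurable_funeneg|by []].
by [].
Qed.

Definition seg : set R := `[-1, 1].

Lemma fdom_seg : fdom seg.
Proof.
split; first exact: measurable_itv.
by rewrite lebesgue_measure_itv/=; case: ifP => // _; rewrite -EFinB ltry.
Qed.

(** The square is not invariant under rotations, the plane is. The vanishing of [G] outside the unit
    disk, a condition preserved by rotation, allows the square to be replaced by the plane. *)
Lemma Rint_seg_rot (c s : R) (G : mR * mR -> R) : c ^+ 2 + s ^+ 2 = 1 -> bm G ->
  (forall x y : R, 1 < x ^+ 2 + y ^+ 2 -> G (x, y) = 0) ->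
  Rintegral lam seg (fun x => Rintegral lam seg (fun y => G (rot c s (x, y)))) =
  Rintegral lam seg (fun x => Rintegral lam seg (fun y => G (x, y))).
Proof.
move=> cs bG G0.
have G0' (x y : R) : 1 < x ^+ 2 + y ^+ 2 -> G (rot c s (x, y)) = 0.
  move=> xy; apply: G0; rewrite /=.
  have -> : (c * x - s * y) ^+ 2 + (s * x + c * y) ^+ 2 =
      (c ^+ 2 + s ^+ 2) * (x ^+ 2 + y ^+ 2) by ring.
  by rewrite cs mul1r.
have sup (H : mR * mR -> R) : (forall x y : R, 1 < x ^+ 2 + y ^+ 2 -> H (x, y) = 0) ->
    Rintegral lam2 (seg `*` seg) H = Rintegral lam2 setT H.
  move=> H0; rewrite Rintegral_mkcond; congr Rintegral; apply/funext => -[x y].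
  rewrite patchE; case: ifPn => // /negP hxy; rewrite H0//.
  rewrite ltNge; apply/negP => xy; apply: hxy; apply: mem_set.
  have x2 := sqr_ge0 x; have y2 := sqr_ge0 y.
  have x1 : x ^+ 2 <= 1 ^+ 2 by rewrite expr1n; lra.
  have y1 : y ^+ 2 <= 1 ^+ 2 by rewrite expr1n; lra.
  split; rewrite /seg /= in_itv /= -ler_norml.
    by rewrite -(ler_pXn2r (n := 2))// ?nnegrE// real_normK ?num_real.
  by rewrite -(ler_pXn2r (n := 2))// ?nnegrE// real_normK ?num_real.
have bGr : bm (fun p => G (rot c s p)) by apply: bm_comp bG; exact: measurable_rot.
rewrite (Rint_fubini fdom_seg fdom_seg bGr) (Rint_fubini fdom_seg fdom_seg bG).
by rewrite !sup// Rintegral_rot//; exact: bG.1.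
Qed.

End PlaneRotation.

(** * Ginibre's inequality *)

Section Torus.
Variables (R : realType) (L : finType).
Notation cfgL := (cfg R L).
Notation tint := (iint (@circle R) (enum L)).

Definition torus_periodic (f : cfgL -> R) :=
  forall (k : L -> int) v, f (fun i => v i + (k i)%:~R * (2 * pi)) = f v.

Lemma measurable_add d (T : measurableType d) (u w : T -> cfgL) :
  measurable_fun setT u -> measurable_fun setT w ->
  measurable_fun setT (fun t => (fun i => u t i + w t i) : cfgL).
Proof.
move=> mu mw; apply: measurable_cfg => i.
by apply: measurable_funD; exact: measurable_cfg_coord.
Qed.

Lemma measurable_scale d (T : measurableType d) (c : R) (u : T -> cfgL) :
  measurable_fun setT u -> measurable_fun setT (fun t => (fun i => c * u t i) : cfgL).
Proof.
move=> mu; apply: measurable_cfg => i; apply: measurable_funM; first exact: measurable_cst.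
exact: measurable_cfg_coord.
Qed.

Lemma iint_shift s (c : cfgL) f : uniq s -> bm f -> torus_periodic f ->
  iint (@circle R) s (fun v => f (fun i => if i \in s then v i + c i else v i)) =
  iint (@circle R) s f.
Proof.
elim: s f => [//|i s IH] f /= /andP[is_ us] bf pf.
pose g r := iint (@circle R) s (fun v => f (upd i r v)).
transitivity (Rintegral lam (@circle R) (fun r => g (r + c i))).
  apply: eq_Rintegral => r _; rewrite /g -[RHS]IH//.
  - congr iint; apply/funext => v; congr f; apply/funext => j; rewrite /upd inE.
    by have [->|ji] //= := eqVneq j i; rewrite (negbTE is_).
  - exact: bm_upd.
  - move=> k v; rewrite -[RHS](pf (fun j => if j == i then 0 else k j)); congr f.
    by apply/funext => j; rewrite /upd; case: eqP => // _; rewrite mul0r addr0.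
rewrite (@Rint_circle_shift R (c i) g)//; first exact: (bm_iint_upd (@fdom_circle R)).
move=> r; rewrite /g; congr iint; apply/funext => v.
rewrite -[RHS](pf (fun j => (j == i)%:R)); congr f; apply/funext => j; rewrite /upd.
by case: eqP => // _; rewrite ?mul1r// mul0r addr0.
Qed.

Lemma tint_shift (c : cfgL) f : bm f -> torus_periodic f ->
  tint (fun v => f (fun i => v i + c i)) = tint f.
Proof.
move=> bf pf; rewrite -(iint_shift c (enum_uniq L) bf pf); congr iint.
by apply/funext => v; congr f; apply/funext => i; rewrite mem_enum.
Qed.

Definition tvol : R := fine (lam (@circle R)) ^+ size (enum L).

Lemma tvol_gt0 : 0 < tvol.
Proof.
apply: exprn_gt0; rewrite /circle lebesgue_measure_itv/= lte_fin mulr_gt0 ?pi_gt0//=.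
by rewrite subr0 mulr_gt0 ?pi_gt0.
Qed.

Lemma tint_cst (c : R) : tint (fun=> c) = c * tvol.
Proof. by rewrite (iint_cst (@fdom_circle R)). Qed.

(* Averaging over [s] the translation by [s / 2] turns invariance under
   translations into invariance under doubling. *)
Lemma tint_double f : bm f -> torus_periodic f ->
  tint (fun v => f (fun i => 2 * v i)) = tint f.
Proof.
move=> bf pf; apply: (mulIf (lt0r_neq0 tvol_gt0)).
have bd : bm (fun v : cfgL => f (fun i => 2 * v i)).
  by apply: (bm_comp _ bf); apply: measurable_scale; exact: measurable_id.
pose F (p : cfgL * cfgL) := f (fun i => p.2 i + 2 * p.1 i).
have bF : bm F.
  apply: (bm_comp _ bf); apply: measurable_add => //.
  by apply: measurable_scale.
rewrite -!tint_cst.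
transitivity (tint (fun s => tint (fun v => F (v, s)))).
  congr iint; apply/funext => s.
  rewrite -(tint_shift (fun i => s i / 2) bd).
    congr iint; apply/funext => v; congr f; apply/funext => i /=.
    by rewrite mulrDr [2 * (s i / 2)]mulrC divfK ?pnatr_eq0// addrC.
  move=> k v; rewrite -[RHS](pf (fun i => k i + k i)); congr f.
  by apply/funext => i; rewrite intrD; ring.
rewrite -(iint_swap (enum L) (enum L) (F := F) (@fdom_circle R) (@fdom_circle R) bF).
by congr iint; apply/funext => v; rewrite (tint_shift (fun i => 2 * v i) bf pf).
Qed.

(* Ginibre's change of variables, in the form that is well defined on the torus:
   no angle is halved. *)
Lemma tint_half_angles (F : cfgL * cfgL -> R) : bm F ->
  (forall v, torus_periodic (fun u => F (u, v))) ->
  (forall u, torus_periodic (fun v => F (u, v))) ->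
  tint (fun v => tint (fun u => F ((fun i => u i - v i), (fun i => u i + v i)))) =
  tint (fun u => tint (fun v => F (u, v))).
Proof.
move=> bF pF1 pF2.
(* Translating u by v turns the pair (u - v, u + v) into (u, u + 2 v); invariance under doubling of
   v and then under translation by u turns the second entry into v. *)
pose G (p : cfgL * cfgL) := F (p.1, fun i => p.1 i + 2 * p.2 i).
have bG : bm G.
  apply: (bm_comp _ bF); apply: measurable_fun_pair => //.
  by apply: measurable_add => //; apply: measurable_scale.
have bF1 u : bm (fun v => F (u, v)).
  by apply: (bm_comp _ bF); exact: pair1_measurable.
transitivity (tint (fun v => tint (fun u => G (u, v)))).
  congr iint; apply/funext => v.
  rewrite -[RHS](tint_shift (fun i => - v i)).
  - congr iint; apply/funext => u; congr (F (_, _)); apply/funext => i /=.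
    by ring.
  - by apply: (bm_comp _ bG); exact: pair2_measurable.
  - move=> k u; rewrite /G /=.
    rewrite -[RHS](pF1 _ k) -[RHS](pF2 _ k); congr (F (_, _)).
    by apply/funext => i; ring.
rewrite -(iint_swap (enum L) (enum L) (F := G) (@fdom_circle R) (@fdom_circle R) bG).
congr iint; apply/funext => u; rewrite /G /=.
rewrite (tint_double (f := fun v => F (u, fun i => u i + v i))).
- rewrite -[RHS](tint_shift u (bF1 u) (pF2 u)); congr iint; apply/funext => v.
  by congr (F (_, _)); apply/funext => i; rewrite addrC.
- apply: (bm_comp _ (bF1 u)); apply: measurable_add; first exact: measurable_cst.
  exact: measurable_id.
- move=> k v; rewrite -[RHS](pF2 u k); congr (F (_, _)).
  by apply/funext => i; rewrite addrA.
Qed.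

End Torus.

(** The remainder at x is dominated term by term by the remainder at [B], so convergence of the
    series at the single point [B] gives a uniform estimate. *)
Lemma expR_uniform_approx (R : realType) (B e : R) : 0 < e ->
  exists n, forall x, `|x| <= B -> `|expR x - \sum_(k < n) k`!%:R^-1 * x ^+ k| <= e.
Proof.
move=> e0.
have cvx (x : R) : series (exp_coeff x) @ \oo --> expR x by exact: is_cvg_series_exp_coeff.
have /cvgrPdist_le/(_ _ e0)[n _ /(_ n (leqnn n)) hn] := cvx B.
exists n => x xB.
have sE : \sum_(k < n) k`!%:R^-1 * x ^+ k = series (exp_coeff x) n.
  by rewrite /series /= big_mkord; apply: eq_bigr => k _; rewrite mulrC.
rewrite sE; apply: le_trans (le_trans (ler_norm _) hn).
have cl : `|series (exp_coeff x) m - series (exp_coeff x) n| @[m --> \oo] -->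
    `|expR x - series (exp_coeff x) n|.
  by apply: cvg_norm; apply: cvgB; [exact: cvx | exact: cvg_cst].
have cr : series (exp_coeff B) m - series (exp_coeff B) n @[m --> \oo] -->
    expR B - series (exp_coeff B) n.
  by apply: cvgB; [exact: cvx | exact: cvg_cst].
apply: (ler_cvg_to cl cr); exists n => // m /= nm.
rewrite !sub_series_geq// (le_trans (ler_norm_sum _ _ _))//.
apply: ler_sum => k _; rewrite /exp_coeff /= normrM normrX.
rewrite [X in _ * X]ger0_norm ?invr_ge0 ?ler0n//.
by rewrite ler_wpM2r ?invr_ge0 ?ler0n// lerXn2r ?nnegrE// (le_trans _ xB).
Qed.

(** * Positive semidefinite kernels on the torus *)

Section SumsOfSquares.
Variables (R : realType) (L : finType).
Notation cfgL := (cfg R L).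
Notation tint := (iint (@circle R) (enum L)).

(** Positive semidefinite kernels of finite rank. Finite rank keeps sums, products and integrals
    elementary, but is in general lost under the exponential. *)
Definition sos (K : cfgL -> cfgL -> R) :=
  exists (J : finType) (h : J -> cfgL -> R),
    (forall j, bm (h j)) /\ forall u v, K u v = \sum_j h j u * h j v.

Lemma eq_sos K1 K2 : (forall u v, K1 u v = K2 u v) -> sos K1 -> sos K2.
Proof.
by move=> e [J [h [bh hE]]]; exists J, h; split => // u v; rewrite -e.
Qed.

Lemma sos_square (c : R) h : 0 <= c -> bm h -> sos (fun u v => c * (h u * h v)).
Proof.
move=> c0 bh; exists unit, (fun _ u => Num.sqrt c * h u); split => [_|u v]; first exact: bmZ.
by rewrite big_const card_unit /= addr0 mulrACA -expr2 sqr_sqrtr.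
Qed.

Lemma sos_cst (c : R) : 0 <= c -> sos (fun _ _ => c).
Proof.
move=> c0; apply: (eq_sos _ (sos_square c0 (bm_cst _ 1))) => u v.
by rewrite !mulr1.
Qed.

Lemma sosD K1 K2 : sos K1 -> sos K2 -> sos (fun u v => K1 u v + K2 u v).
Proof.
move=> [J1 [h1 [bh1 E1]]] [J2 [h2 [bh2 E2]]].
exists (J1 + J2)%type, (fun j => match j with inl j => h1 j | inr j => h2 j end).
split=> [[j|j]//|u v]; by rewrite big_sumType E1 E2.
Qed.

Lemma sosM K1 K2 : sos K1 -> sos K2 -> sos (fun u v => K1 u v * K2 u v).
Proof.
move=> [J1 [h1 [bh1 E1]]] [J2 [h2 [bh2 E2]]].
exists (J1 * J2)%type, (fun j u => h1 j.1 u * h2 j.2 u).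
split=> [j|u v]; first exact: bmM.
rewrite E1 E2 big_distrlr pair_big /=; apply: eq_bigr => -[i j] _ /=.
by rewrite mulrACA.
Qed.

Lemma sos_sum (I : Type) (s : seq I) (P : pred I) (K : I -> cfgL -> cfgL -> R) :
  (forall i, P i -> sos (K i)) -> sos (fun u v => \sum_(i <- s | P i) K i u v).
Proof.
move=> hK; elim: s => [|i s IH].
  by apply: (eq_sos _ (sos_cst (lexx 0))) => u v; rewrite big_nil.
have [Pi|Pi] := boolP (P i).
  by apply: (eq_sos _ (sosD (hK _ Pi) IH)) => u v; rewrite big_cons Pi.
by apply: (eq_sos _ IH) => u v; rewrite big_cons (negbTE Pi).
Qed.

Lemma sosX K n : sos K -> sos (fun u v => K u v ^+ n).
Proof.
move=> sK; elim: n => [|n IH]; first exact: sos_cst.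
by apply: (eq_sos _ (sosM sK IH)) => u v; rewrite exprS.
Qed.

Lemma bm_sos K : sos K -> bm (fun p : cfgL * cfgL => K p.2 p.1).
Proof.
move=> [J [h [bh hE]]].
apply: (@eq_bm _ _ _ (fun p : cfgL * cfgL => \sum_j h j p.2 * h j p.1)).
  by move=> p; rewrite hE.
apply: bm_sum => j _; apply: bmM.
  by apply: (bm_comp _ (bh j)).
by apply: (bm_comp _ (bh j)).
Qed.

Lemma bm_tint (K : cfgL * cfgL -> R) : bm K -> bm (fun v => tint (fun u => K (v, u))).
Proof. by move=> bK; apply: (bm_iint (@fdom_circle R)). Qed.

Lemma bm_section (K : cfgL * cfgL -> R) v : bm K -> bm (fun u => K (v, u)).
Proof. by move=> bK; apply: (bm_comp _ bK); exact: pair1_measurable. Qed.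

(** Each term h(u) h(v) integrates to the square of the integral of h. *)
Lemma sos_tint_ge0 K : sos K -> 0 <= tint (fun v => tint (fun u => K u v)).
Proof.
move=> [J [h [bh hE]]].
have -> : tint (fun v => tint (fun u => K u v)) = \sum_j tint (h j) ^+ 2.
  transitivity (tint (fun v => \sum_j tint (h j) * h j v)).
    congr iint; apply/funext => v.
    transitivity (tint (fun u => \sum_j h j v * h j u)).
      by congr iint; apply/funext => u; rewrite hE; apply: eq_bigr => j _; rewrite mulrC.
    rewrite (iint_sum (@fdom_circle R)); last by move=> j; apply: bmZ.
    by apply: eq_bigr => j _; rewrite (iintZ (@fdom_circle R))// mulrC.
  rewrite (iint_sum (@fdom_circle R)); last by move=> j; apply: bmZ.
  by apply: eq_bigr => j _; rewrite (iintZ (@fdom_circle R)).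
by apply: sumr_ge0 => j _; exact: sqr_ge0.
Qed.

(** The Taylor polynomials of exp have nonnegative coefficients, so evaluating them at [X] stays
    within [sos]; they converge uniformly on the bounded range of [X], and nonnegativity passes to
    the limit. *)
Lemma sos_expR_tint_ge0 X G : sos X -> sos G ->
  0 <= tint (fun v => tint (fun u => expR (X u v) * G u v)).
Proof.
move=> sX sG.
have bX := bm_sos sX; have bG := bm_sos sG.
have [_ [B hB]] := bX; have [_ [M hM]] := bG.
have hD := @fdom_circle R.
rewrite -[X in _ <= X]opprK oppr_ge0; apply/ler_addgt0Pl => d d0; rewrite addr0.
(* Chosen so that the error [e] of the exponential, times a bound on [G], integrates to [d] over the
   two tori. The added 1 keeps the denominator positive. *)
pose e := d / ((`|M| + 1) * tvol R L ^+ 2).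
have M1 : 0 < `|M| + 1 by rewrite ltr_wpDl.
have t0 := tvol_gt0 R L.
have e0 : 0 < e by rewrite divr_gt0// mulr_gt0// exprn_gt0.
have [n hn] := expR_uniform_approx B e0.
pose S u v := \sum_(k < n) k`!%:R^-1 * X u v ^+ k.
have sS : sos S.
  apply: sos_sum => k _; apply: sosM; last exact: sosX.
  by apply: sos_cst; rewrite invr_ge0 ler0n.
have sSG := sosM sS sG.
have bE : bm (fun p : cfgL * cfgL => expR (X p.2 p.1) * G p.2 p.1).
  by apply: bmM => //; exact: bm_expR.
have key u v : S u v * G u v - d / tvol R L ^+ 2 <= expR (X u v) * G u v.
  rewrite lerBlDr -lerBlDl -mulrBl (le_trans (ler_norm _))// normrM distrC.
  have -> : d / tvol R L ^+ 2 = e * (`|M| + 1).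
    by rewrite /e; field; rewrite !gt_eqF.
  apply: ler_pM => //; first exact: hn (hB (v, u)).
  by rewrite (le_trans (hM (v, u)))// (le_trans (ler_norm _))// lerDl.
rewrite lerNl.
have -> : - d = 0 - d / tvol R L ^+ 2 * tvol R L * tvol R L.
  by field; rewrite gt_eqF.
apply: le_trans (_ : tint (fun v => tint (fun u => S u v * G u v - d / tvol R L ^+ 2)) <= _).
  rewrite [X in _ <= iint _ _ X](_ : _ =
      (fun v => tint (fun u => S u v * G u v) - d / tvol R L ^+ 2 * tvol R L)).
    rewrite (iintB hD); last exact: bm_cst.
      by rewrite tint_cst lerB// sos_tint_ge0.
    exact: (bm_tint (bm_sos sSG)).
  apply/funext => v; rewrite (iintB hD); last exact: bm_cst.
    by rewrite tint_cst.
  exact: (bm_section v (bm_sos sSG)).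
apply: (le_iint hD) => [||v].
- by apply: (bm_tint (K := fun p => S p.2 p.1 * G p.2 p.1 - _)); apply: bmB; [exact: (bm_sos sSG)|exact: bm_cst].
- exact: (bm_tint bE).
apply: (le_iint hD) => [||u].
- by apply: bmB; [exact: (bm_section v (bm_sos sSG))|exact: bm_cst].
- exact: (bm_section v bE).
exact: key.
Qed.

End SumsOfSquares.

(** * Comparison of XY correlations for two families of couplings *)

Section Ginibre.
Variables (R : realType) (L : finType).
Notation cfgL := (cfg R L).
Notation tint := (iint (@circle R) (enum L)).

Definition cos_diff (m : nat) (x y : L) (th : cfgL) : R := cos (m%:R * (th x - th y)).

Lemma measurable_diff (c : R) (x y : L) :
  measurable_fun setT (fun th : cfgL => c * (th x - th y)).
Proof.
apply: measurable_funM; first exact: measurable_cst.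
by apply: measurable_funB; exact: measurable_coord.
Qed.

Lemma bm_cos_diff m x y : bm (cos_diff m x y).
Proof. by apply: bm_cos; exact: measurable_diff. Qed.

Lemma bm_sin_diff (m : nat) (x y : L) : bm (fun th : cfgL => sin (m%:R * (th x - th y))).
Proof. by apply: bm_sin; exact: measurable_diff. Qed.

Lemma energyXYE (J : L -> L -> R) (th : cfgL) :
  energyXY J th = 2^-1 * \sum_(x : L) \sum_(y : L | y != x) J x y * cos_diff 1 x y th.
Proof.
by rewrite /energyXY; congr (_ * _); apply: eq_bigr => x _; apply: eq_bigr => y _;
  rewrite /cos_diff mul1r.
Qed.

Lemma bm_energyXY (J : L -> L -> R) : bm (energyXY J : cfgL -> R).
Proof.
apply: (@eq_bm _ _ _ (fun th : cfgL =>
  2^-1 * \sum_(x : L) \sum_(y : L | y != x) J x y * cos_diff 1 x y th)).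
  by move=> th; rewrite energyXYE.
by apply: bmZ; apply: bm_sum => x _; apply: bm_sum => y _; apply: bmZ; exact: bm_cos_diff.
Qed.

Lemma periodic_cos_diff m x y : torus_periodic (cos_diff m x y).
Proof.
move=> k th; rewrite /cos_diff.
have cp : periodic (@cos R) (2 * pi) by move=> t; rewrite mulr_natl cosD2pi.
rewrite -[RHS](periodicz (m%:Z * (k x - k y)) cp); congr cos.
by rewrite intrM intrB -pmulrn; ring.
Qed.

Lemma periodic_energyXY (J : L -> L -> R) : torus_periodic (energyXY J : cfgL -> R).
Proof.
move=> k th; rewrite [LHS]energyXYE [RHS]energyXYE; congr (_ * _).
by apply: eq_bigr => x _; apply: eq_bigr => y _; rewrite periodic_cos_diff.
Qed.

Section Comparison.
Variables (J K : L -> L -> R).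
Hypothesis hJK : forall x y : L, x != y -> `|K x y| <= J x y.
Variables (m : nat) (x0 y0 : L).

Let weight (p : cfgL * cfgL) : R := expR (energyXY J p.1 + energyXY K p.2).

(** [b] selects the sum or the difference of the two cosines; the two cases together give the
    absolute value in [ginibre_comparison]. *)
Let F (b : bool) (p : cfgL * cfgL) : R :=
  weight p * (cos_diff m x0 y0 p.1 + (-1) ^+ b * cos_diff m x0 y0 p.2).

Let bm_fst (f : cfgL -> R) : bm f -> bm (fun p : cfgL * cfgL => f p.1).
Proof. by move=> bf; apply: (bm_comp _ bf). Qed.

Let bm_snd (f : cfgL -> R) : bm f -> bm (fun p : cfgL * cfgL => f p.2).
Proof. by move=> bf; apply: (bm_comp _ bf). Qed.

Let bF b : bm (F b).
Proof.
apply: bmM.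
  by apply: bm_expR; apply: bmD; [apply: bm_fst|apply: bm_snd]; exact: bm_energyXY.
apply: bmD; first by apply: bm_fst; exact: bm_cos_diff.
by apply: bmZ; apply: bm_snd; exact: bm_cos_diff.
Qed.

Lemma ginibre_duplicated b : 0 <= tint (fun u => tint (fun v => F b (u, v))).
Proof.
rewrite -(tint_half_angles (bF b)); first last.
- by move=> u k v; rewrite /F /weight /= periodic_energyXY periodic_cos_diff.
- by move=> v k u; rewrite /F /weight /= periodic_energyXY periodic_cos_diff.
have cosine_pm (n : nat) (u v : cfgL) (x y : L) :
    let a := n%:R * (u x - u y) in let b := n%:R * (v x - v y) in
    (cos_diff n x y (fun i => u i - v i) = cos a * cos b + sin a * sin b) *
    (cos_diff n x y (fun i => u i + v i) = cos a * cos b - sin a * sin b).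
  move=> /=; split; rewrite /cos_diff.
    by rewrite -cosB; congr cos; ring.
  by rewrite -cosD; congr cos; ring.
(* J cos (a - b) + K cos (a + b) = (J + K) cos a cos b + (J - K) sin a sin b, and |K| <= J makes
   both coefficients nonnegative. *)
pose X (u v : cfgL) := 2^-1 * \sum_(x : L) \sum_(y : L | y != x)
  ((J x y + K x y) * (cos_diff 1 x y u * cos_diff 1 x y v) +
   (J x y - K x y) * (sin (1 * (u x - u y)) * sin (1 * (v x - v y)))).
pose G (u v : cfgL) := if b
  then 2 * (sin (m%:R * (u x0 - u y0)) * sin (m%:R * (v x0 - v y0)))
  else 2 * (cos_diff m x0 y0 u * cos_diff m x0 y0 v).
have sX : sos X.
  apply: sosM; first by apply: sos_cst; rewrite invr_ge0.
  apply: sos_sum => x _; apply: sos_sum => y yx; rewrite eq_sym in yx.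
  have := hJK yx; rewrite ler_norml => /andP[h1 h2].
  apply: sosD; apply: sos_square; [lra|exact: bm_cos_diff|lra|exact: (bm_sin_diff 1)].
have sG : sos G.
  by rewrite /G; case: (b); apply: sos_square => //; [exact: bm_sin_diff|exact: bm_cos_diff].
have := sos_expR_tint_ge0 sX sG; congr (_ <= _).
congr iint; apply/funext => v; congr iint; apply/funext => u.
rewrite /F /weight /=; congr (expR _ * _).
  rewrite !energyXYE -mulrDr -big_split /=; congr (_ * _).
  apply: eq_bigr => x _; rewrite -big_split /=; apply: eq_bigr => y _.
  by rewrite !cosine_pm /cos_diff; ring.
by rewrite /G !cosine_pm /cos_diff; case: (b); rewrite ?expr1 ?expr0; ring.
Qed.

Lemma tint_product2 (e : R) (f g f' g' : cfgL -> R) : bm f -> bm g -> bm f' -> bm g' ->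
  tint (fun u => tint (fun v => f u * g v + e * (f' u * g' v))) =
  tint f * tint g + e * (tint f' * tint g').
Proof.
move=> bf bg bf' bg'; have hD := @fdom_circle R.
transitivity (tint (fun u => tint g * f u + (e * tint g') * f' u)).
  congr iint; apply/funext => u.
  rewrite (iintD hD); [|exact: bmZ|by apply: bmZ; exact: bmZ].
  by rewrite !(iintZ hD)//; [ring|exact: bmZ].
by rewrite (iintD hD) ?(iintZ hD)//; [ring|exact: bmZ|exact: bmZ].
Qed.

Let Z (A : L -> L -> R) := tint (fun th => expR (energyXY A th)).
Let C (A : L -> L -> R) := tint (fun th => expR (energyXY A th) * cos_diff m x0 y0 th).

(** The two copies are independent, so the duplicated integral factors into [C J * Z K] plus or
    minus [C K * Z J]. *)
Lemma ginibre_comparison : `|C K| * Z J <= C J * Z K.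
Proof.
have bZ (A : L -> L -> R) : bm (fun th : cfgL => expR (energyXY A th)).
  by apply: bm_expR; exact: bm_energyXY.
have bC (A : L -> L -> R) : bm (fun th : cfgL => expR (energyXY A th) * cos_diff m x0 y0 th).
  by apply: bmM => //; exact: bm_cos_diff.
have FE b : tint (fun u => tint (fun v => F b (u, v))) = C J * Z K + (-1) ^+ b * (C K * Z J).
  rewrite [C K * _]mulrC -tint_product2//.
  congr iint; apply/funext => u; congr iint; apply/funext => v.
  by rewrite /F /weight /= expRD; ring.
have h0 := ginibre_duplicated false; have h1 := ginibre_duplicated true.
rewrite !FE expr0 expr1 in h0 h1.
have ZJ0 : 0 <= Z J.
  rewrite -[leLHS](mul0r (tvol R L)) -tint_cst.
  apply: (le_iint (@fdom_circle R)) => [||th]; [exact: bm_cst|exact: bZ|exact: expR_ge0].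
by rewrite -[Z J in X in X <= _]ger0_norm// -normrM ler_norml; apply/andP; split; lra.
Qed.

End Comparison.

Lemma partition_XY_gt0 (A : L -> L -> R) : 0 < tint (fun th => expR (energyXY A th)).
Proof.
have [_ [B hB]] := bm_energyXY A.
apply: (@lt_le_trans _ _ (tint (fun=> expR (- B)))).
  by rewrite tint_cst mulr_gt0 ?expR_gt0 ?tvol_gt0.
apply: (le_iint (@fdom_circle R)); [exact: bm_cst|by apply: bm_expR; exact: bm_energyXY|].
by move=> th; rewrite ler_expR; have := hB th; rewrite ler_norml => /andP[].
Qed.

End Ginibre.

(** * Planar rotations of the spins *)

Section Spins.
Variables (R : realType) (L : finType) (N : nat).
Notation site := (L * 'I_N)%type.
Notation cfgN := (cfg R site).
Notation spins := (L -> 'I_N -> R).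

Lemma invr_sqrt_powR (a : R) : 0 <= a -> (Num.sqrt a)^-1 = a `^ (- 2^-1).
Proof. by move=> a0; rewrite powRN powR12_sqrt. Qed.

(** The sum is 1 except at the zero vector, where division by zero makes it 0. Working with an
    inequality avoids discarding that null set. *)
Lemma sum_normalize_le1 (v : cfgN) x : \sum_k normalize v x k ^+ 2 <= 1.
Proof.
have S0 : 0 <= \sum_(j < N) v (x, j) ^+ 2 by apply: sumr_ge0 => k _; exact: sqr_ge0.
rewrite /normalize; under eq_bigr do rewrite exprMn exprVn sqr_sqrtr//.
rewrite -mulr_suml; have [->|S1] := eqVneq (\sum_(j < N) v (x, j) ^+ 2) 0.
  by rewrite mul0r.
by rewrite divff.
Qed.

Lemma normalize_le1 (v : cfgN) x k : `|normalize v x k| <= 1.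
Proof.
have h : normalize v x k ^+ 2 <= 1 ^+ 2.
  rewrite expr1n (le_trans _ (sum_normalize_le1 v x))// (bigD1 k)//= lerDl.
  by apply: sumr_ge0 => l _; exact: sqr_ge0.
by rewrite -(ler_pXn2r (n := 2))// ?nnegrE// real_normK ?num_real.
Qed.

Lemma measurable_sqnorm x : measurable_fun setT (fun v : cfgN => \sum_(j < N) v (x, j) ^+ 2).
Proof.
apply: measurable_sum => k; apply: measurable_funX.
exact: measurable_coord.
Qed.

Lemma bm_normalize x k : bm (fun v : cfgN => normalize v x k).
Proof.
split; last by exists 1 => v; exact: normalize_le1.
apply: measurable_funM; first exact: measurable_coord.
rewrite (_ : (fun _ => _) = (fun v : cfgN => (\sum_(j < N) v (x, j) ^+ 2) `^ (- 2^-1))).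
  exact: (measurableT_comp (@measurable_powR R (- 2^-1)) (measurable_sqnorm x)).
by apply/funext => v; rewrite invr_sqrt_powR// sumr_ge0// => j _; exact: sqr_ge0.
Qed.

Lemma bm_inball : bm (@inball R L N : cfgN -> R).
Proof.
apply: bm_prod => x _; apply: bm_if; [|exact: bm_cst|exact: bm_cst].
apply: measurable_fun_ler; [exact: measurable_sqnorm|exact: measurable_cst].
Qed.

Lemma bm_energyN (J : L -> L -> R) : bm (fun v : cfgN => energyN J (normalize v)).
Proof.
apply: bmZ; apply: bm_sum => x _; apply: bm_sum => y _; apply: bmZ.
by apply: bm_sum => k _; apply: bmM; exact: bm_normalize.
Qed.

Section Rotation.
Variables (i j : 'I_N) (hij : i != j).

(** The angle may depend on the site: independent angles become the XY variables, while a constant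
    angle preserves the energy. *)
Definition rotv (al : L -> R) (v : cfgN) : cfgN := fun p =>
  if p.2 == i then cos (al p.1) * v (p.1, i) - sin (al p.1) * v (p.1, j)
  else if p.2 == j then sin (al p.1) * v (p.1, i) + cos (al p.1) * v (p.1, j)
  else v p.

Definition rots (al : L -> R) (s : spins) : spins := fun x k =>
  if k == i then cos (al x) * s x i - sin (al x) * s x j
  else if k == j then sin (al x) * s x i + cos (al x) * s x j
  else s x k.

Lemma rotvi al v x : rotv al v (x, i) = cos (al x) * v (x, i) - sin (al x) * v (x, j).
Proof. by rewrite /rotv /= eqxx. Qed.

Lemma rotvj al v x : rotv al v (x, j) = sin (al x) * v (x, i) + cos (al x) * v (x, j).
Proof. by rewrite /rotv /= eqxx eq_sym (negbTE hij). Qed.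

Lemma sum_split (F : 'I_N -> R) :
  \sum_k F k = F i + F j + \sum_(k | (k != i) && (k != j)) F k.
Proof. by rewrite (bigD1 i)//= (bigD1 j) 1?eq_sym//= addrA. Qed.

Lemma cos_sin_rot (a p q : R) :
  (cos a * p - sin a * q) ^+ 2 + (sin a * p + cos a * q) ^+ 2 = p ^+ 2 + q ^+ 2.
Proof.
have h := cos2Dsin2 a.
have -> : (cos a * p - sin a * q) ^+ 2 + (sin a * p + cos a * q) ^+ 2 =
   (cos a ^+ 2 + sin a ^+ 2) * (p ^+ 2 + q ^+ 2) by ring.
by rewrite h mul1r.
Qed.

Lemma sqnorm_rotv al v x :
  \sum_(k < N) rotv al v (x, k) ^+ 2 = \sum_(k < N) v (x, k) ^+ 2.
Proof.
rewrite sum_split [RHS]sum_split rotvi rotvj cos_sin_rot; congr (_ + _).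
by apply: eq_bigr => k /andP[ki kj]; rewrite /rotv /= (negbTE ki) (negbTE kj).
Qed.

Lemma inball_rotv al v : inball (rotv al v) = inball v.
Proof. by apply: eq_bigr => x _; rewrite sqnorm_rotv. Qed.

Lemma normalize_rotv al v : normalize (rotv al v) = rots al (normalize v).
Proof.
apply/funext => x; apply/funext => k; rewrite /rots /normalize sqnorm_rotv /rotv /=.
case: eqP => _; first by rewrite mulrBl !mulrA.
by case: eqP => _ //; rewrite mulrDl !mulrA.
Qed.

Lemma rotvD al be v : rotv al (rotv be v) = rotv (fun x => al x + be x) v.
Proof.
apply/funext => -[x k]; rewrite [LHS]/rotv /= rotvi rotvj [RHS]/rotv /= cosD sinD.
have [_|ki] := eqVneq k i; first by ring.
have [_|kj] := eqVneq k j; first by ring.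
by rewrite /rotv /= (negbTE ki) (negbTE kj).
Qed.

Lemma measurable_rotv d (T : measurableType d) (al : T -> cfg R L) (u : T -> cfgN) :
  measurable_fun setT al -> measurable_fun setT u ->
  measurable_fun setT (fun t => rotv (al t) (u t)).
Proof.
move=> mal mu; apply: measurable_cfg => -[x k]; rewrite /rotv /=.
have mc := measurable_cfg_coord x mal.
have mui := measurable_cfg_coord (x, i) mu; have muj := measurable_cfg_coord (x, j) mu.
case: eqP => _.
  by apply: measurable_funB; apply: measurable_funM => //; [exact: (bm_cos mc).1|exact: (bm_sin mc).1].
case: eqP => _; last exact: measurable_cfg_coord.
by apply: measurable_funD; apply: measurable_funM => //; [exact: (bm_sin mc).1|exact: (bm_cos mc).1].
Qed.

Notation ballint := (iint (@seg R) (enum {: site})).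

(** What [Rint_seg_rot] needs at each site. Unlike membership in the cube, the condition is
    invariant under [rotv]; the factor [inball] in the weight ensures it. *)
Definition planar_support (G : cfgN -> R) :=
  forall v x, 1 < v (x, i) ^+ 2 + v (x, j) ^+ 2 -> G v = 0.

Definition single (x : L) (a : R) : cfg R L := fun y => if y == x then a else 0.

Lemma rotv_single_upd x a r t v :
  rotv (single x a) (upd (x, i) r (upd (x, j) t v)) =
  upd (x, i) (cos a * r - sin a * t) (upd (x, j) (sin a * r + cos a * t) v).
Proof.
have ji : j == i = false by rewrite eq_sym (negbTE hij).
apply/funext => -[y k]; rewrite /rotv /upd /single /= !xpair_eqE.
have [->|yx] := eqVneq y x; rewrite /= ?eqxx ?ji /=.
  by case: eqP => // _; case: eqP.
rewrite cos0 sin0; case: eqP => [->|_]; first by ring.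
by case: eqP => [->|_] //; ring.
Qed.

Lemma ballint_rot_single x a (G : cfgN -> R) : bm G -> planar_support G ->
  ballint (fun v => G (rotv (single x a) v)) = ballint G.
Proof.
move=> bG sG; have hD := fdom_seg R.
have bGr : bm (fun v => G (rotv (single x a) v)).
  apply: (bm_comp _ bG); apply: (@measurable_rotv _ _ (fun=> single x a) id) => //.
pose p : site := (x, i); pose q : site := (x, j).
have pq : p != q by rewrite xpair_eqE negb_and hij orbT.
have us := enum_uniq {: site}.
have expand (H : cfgN -> R) : bm H -> ballint H = Rintegral lam (@seg R) (fun r => Rintegral lam (@seg R)
    (fun t => iint (@seg R) (rem q (rem p (enum {: site}))) (fun v => H (upd p r (upd q t v))))).
  move=> bH; rewrite (iint_to_front (i := p) hD us)// ?mem_enum// iint_cons.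
  apply: eq_Rintegral => r _.
  rewrite (iint_to_front (i := q) hD _ _ (bm_upd p r bH)) ?rem_uniq//.
  by rewrite mem_rem_uniq// !inE eq_sym pq mem_enum.
rewrite (expand _ bGr) (expand _ bG).
pose g (z : measurableTypeR R * measurableTypeR R) :=
  iint (@seg R) (rem q (rem p (enum {: site}))) (fun v => G (upd p z.1 (upd q z.2 v))).
have bg : bm g.
  apply: (bm_iint hD _ (F := fun z => G (upd p z.1.1 (upd q z.1.2 z.2)))).
  apply: (bm_comp _ bG); apply: measurable_upd; first exact: measurableT_comp.
  by apply: measurable_upd => //; exact: measurableT_comp.
rewrite -[RHS](Rint_seg_rot (cos2Dsin2 a) bg) => [|r t rt].
  apply: eq_Rintegral => r _; apply: eq_Rintegral => t _.
  by rewrite /g; congr iint; apply/funext => v; rewrite rotv_single_upd.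
rewrite /g -[RHS](mul0r (fine (lam (@seg R)) ^+ size (rem q (rem p (enum {: site}))))).
rewrite -(iint_cst hD); congr iint; apply/funext => v; apply: (sG _ x).
by rewrite /upd /= !eqxx eq_sym (negbTE pq).
Qed.

Lemma ballint_rotv (al : cfg R L) (G : cfgN -> R) : bm G -> planar_support G ->
  ballint (fun v => G (rotv al v)) = ballint G.
Proof.
move=> bG sG.
(* The sites are rotated one after the other: [mask] keeps the angles of those already treated. *)
pose mask (l : seq L) : cfg R L := fun x => if x \in l then al x else 0.
have key (l : seq L) : uniq l -> ballint (fun v => G (rotv (mask l) v)) = ballint G.
  elim: l => [_|x l IH /= /andP[xl ul]].
    congr iint; apply/funext => v; congr G; apply/funext => -[y k].
    rewrite /rotv /mask /= cos0 sin0; case: eqP => [->|_]; first by ring.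
    by case: eqP => [->|_] //; ring.
  rewrite -[RHS]IH//.
  have bGm : bm (fun v => G (rotv (mask l) v)).
    by apply: (bm_comp _ bG); apply: (@measurable_rotv _ _ (fun=> mask l) id).
  rewrite -[RHS](ballint_rot_single x (al x) bGm).
    congr iint; apply/funext => v; rewrite rotvD; congr (G (rotv _ v)).
    apply/funext => y; rewrite /mask /single inE.
    by have [->|_] := eqVneq y x; rewrite ?(negbTE xl)/= ?add0r ?addr0.
  by move=> v y h; apply: (sG _ y); rewrite rotvi rotvj cos_sin_rot.
rewrite -[RHS](key (enum L) (enum_uniq L)); congr iint; apply/funext => v.
by congr (G (rotv _ v)); apply/funext => x; rewrite /mask mem_enum.
Qed.

End Rotation.
End Spins.

Lemma polar_coordinates (R : realType) (p q : R) :
  exists r phi : R, [/\ 0 <= r, p = r * cos phi & q = r * sin phi].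
Proof.
pose r := Num.sqrt (p ^+ 2 + q ^+ 2).
have p2 := sqr_ge0 p; have q2 := sqr_ge0 q.
have r2 : r ^+ 2 = p ^+ 2 + q ^+ 2 by rewrite sqr_sqrtr// addr_ge0.
have [r0|r0] := eqVneq r 0.
  exists 0, 0; rewrite !mul0r; move: r2; rewrite r0 expr0n /= => r2.
  by split => //; apply/eqP; rewrite -sqrf_eq0; apply/eqP; lra.
have rp : 0 < r by rewrite lt0r r0 sqrtr_ge0.
have r2p : 0 < r ^+ 2 by rewrite exprn_gt0.
have hc : -1 <= p / r <= 1.
  rewrite -ler_norml -(ler_pXn2r (n := 2))// ?nnegrE// real_normK ?num_real//.
  by rewrite expr1n exprMn exprVn ler_pdivrMr// mul1r r2; lra.
have hs : sin (acos (p / r)) = `|q| / r.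
  rewrite sin_acos//.
  have -> : 1 - (p / r) ^+ 2 = (`|q| / r) ^+ 2.
    rewrite !exprMn !exprVn real_normK ?num_real//.
    have -> : q ^+ 2 = r ^+ 2 - p ^+ 2 by lra.
    by field.
  by rewrite sqrtr_sqr ger0_norm// divr_ge0// ltW.
(* [acos] takes values in [0, pi], where the sine is nonnegative, so the sign of [q] decides the
   sign of the angle. *)
have [q0|q0] := leP 0 q.
  exists r, (acos (p / r)); rewrite hs acosK ?in_itv//= ger0_norm//.
  by split; rewrite ?(ltW rp)// mulrC divfK.
exists r, (- acos (p / r)); rewrite cosN sinN hs acosK ?in_itv//= ltr0_norm//.
by split; rewrite ?(ltW rp)// ?mulNr ?opprK mulrC divfK.
Qed.

(** * Comparison with the XY model in one coordinate plane *)

Section Planar.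
Variables (R : realType) (L : finType) (N : nat) (J J' : L -> L -> R).
Hypothesis hJJ' : forall x y : L, x != y -> `|J' x y| <= J x y.
Notation site := (L * 'I_N)%type.
Notation cfgN := (cfg R site).
Notation spins := (L -> 'I_N -> R).
Notation ballint := (iint (@seg R) (enum {: site})).
Notation tint := (iint (@circle R) (enum L)).

Definition weight (v : cfgN) : R := inball v * expR (energyN J' (normalize v)).
Definition wint (f : spins -> R) : R := ballint (fun v => weight v * f (normalize v)).
(** Polynomials in the spins are in general bounded only along normalized configurations. *)
Definition spin_bm (f : spins -> R) := bm (fun v : cfgN => f (normalize v)).

Lemma bm_weight : bm weight.
Proof. by apply: bmM; [exact: bm_inball|apply: bm_expR; exact: bm_energyN]. Qed.

Lemma inball_ge0 (v : cfgN) : 0 <= inball v.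
Proof. by apply: prodr_ge0 => x _; case: ifP. Qed.

Lemma weight_ge0 v : 0 <= weight v.
Proof. by rewrite mulr_ge0 ?expR_ge0 ?inball_ge0. Qed.

Lemma bm_wint f : spin_bm f -> bm (fun v => weight v * f (normalize v)).
Proof. by move=> bf; apply: bmM => //; exact: bm_weight. Qed.

Lemma wintD f g : spin_bm f -> spin_bm g -> wint (fun s => f s + g s) = wint f + wint g.
Proof.
move=> bf bg; rewrite /wint -(iintD (fdom_seg R)); [|exact: bm_wint..].
by congr iint; apply/funext => v; rewrite mulrDr.
Qed.

Lemma wintZ c f : spin_bm f -> wint (fun s => c * f s) = c * wint f.
Proof.
move=> bf; rewrite /wint -(iintZ (fdom_seg R)); last exact: bm_wint.
by congr iint; apply/funext => v; rewrite mulrCA.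
Qed.

Lemma wint_sum (K : Type) (l : seq K) (P : pred K) (F : K -> spins -> R) :
  (forall k, spin_bm (F k)) ->
  wint (fun s => \sum_(k <- l | P k) F k s) = \sum_(k <- l | P k) wint (F k).
Proof.
move=> bF; rewrite /wint -(iint_sum (fdom_seg R)); last by move=> k; exact: bm_wint.
by congr iint; apply/funext => v; rewrite mulr_sumr.
Qed.

Lemma le_wint f g : spin_bm f -> spin_bm g -> (forall v, f (normalize v) <= g (normalize v)) ->
  wint f <= wint g.
Proof.
move=> bf bg fg; apply: (le_iint (fdom_seg R)) => [||v]; [exact: bm_wint..|].
by rewrite ler_wpM2l ?weight_ge0.
Qed.

Section Plane.
Variables (i j : 'I_N) (hij : i != j).

Definition plane_norm (s : spins) (x : L) := Num.sqrt (s x i ^+ 2 + s x j ^+ 2).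

Lemma plane_norm_sqr s x : plane_norm s x ^+ 2 = s x i ^+ 2 + s x j ^+ 2.
Proof. by rewrite sqr_sqrtr// addr_ge0 ?sqr_ge0. Qed.

Lemma bm_plane_norm x : spin_bm (fun s => plane_norm s x).
Proof.
have bs : bm (fun v : cfgN => normalize v x i ^+ 2 + normalize v x j ^+ 2).
  by apply: bmD; apply: bmX; exact: bm_normalize.
split.
  rewrite (_ : (fun _ => _) = (fun v : cfgN =>
      (normalize v x i ^+ 2 + normalize v x j ^+ 2) `^ 2^-1)).
    exact: (measurableT_comp (@measurable_powR R 2^-1) bs.1).
  by apply/funext => v; rewrite /plane_norm powR12_sqrt// addr_ge0 ?sqr_ge0.
exists 2 => v; rewrite ger0_norm ?sqrtr_ge0//.
have h (k : 'I_N) : normalize v x k ^+ 2 <= 1.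
  have := normalize_le1 v x k; rewrite -(ler_pXn2r (n := 2))// ?nnegrE//.
  by rewrite real_normK ?num_real// expr1n.
rewrite -(ler_pXn2r (n := 2))// ?nnegrE ?sqrtr_ge0// plane_norm_sqr.
by have := h i; have := h j; lra.
Qed.

Lemma planar_support_weight f : planar_support i j (fun v => weight v * f (normalize v)).
Proof.
move=> v x h; rewrite /weight /inball (bigD1 x)//= ifF ?mul0r//.
apply/negbTE; rewrite -ltNge (lt_le_trans h)// (sum_split hij) lerDl.
by apply: sumr_ge0 => k _; exact: sqr_ge0.
Qed.

(** Every rotation leaves the integral unchanged, so it may be averaged over the angles; exchanging
    the integrations leaves an angular integral for each fixed [v]. *)
Lemma ballint_average (G : cfgN -> R) : bm G -> planar_support i j G ->
  ballint G * tvol R L = ballint (fun v => tint (fun al => G (rotv i j al v))).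
Proof.
move=> bG sG.
rewrite -tint_cst.
rewrite -(iint_swap (enum L) (enum {: site}) (F := fun p => G (rotv i j p.1 p.2)) (@fdom_circle R) (fdom_seg R)).
  by congr iint; apply/funext => al; rewrite ballint_rotv.
by apply: (bm_comp _ bG); exact: measurable_rotv.
Qed.

Lemma wint_rots (al : cfg R L) f : spin_bm f ->
  wint f = ballint (fun v => weight (rotv i j al v) * f (rots i j al (normalize v))).
Proof.
move=> bf; rewrite /wint -(ballint_rotv hij al (bm_wint bf) (@planar_support_weight f)).
by congr iint; apply/funext => v; rewrite normalize_rotv.
Qed.

Variables (m : nat) (x0 y0 : L).

Definition XYcos := gibbsXY J (fun th => cos (m%:R * (th x0 - th y0))).

Lemma XYcos_bound (K : L -> L -> R) : (forall x y : L, x != y -> `|K x y| <= J x y) ->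
  `|tint (fun th => expR (energyXY K th) * cos_diff m x0 y0 th)| <=
  XYcos * tint (fun th => expR (energyXY K th)).
Proof.
move=> hK; have Z0 := partition_XY_gt0 J.
rewrite /XYcos /gibbsXY mulrAC ler_pdivlMr//.
exact: (ginibre_comparison hK m x0 y0).
Qed.

Variable f : spins -> R.
Hypothesis bf : spin_bm f.
(** Required for every polar representation, so that the angle is free where r vanishes and rotated
    angles need no reduction modulo 2 pi. *)
Hypothesis hf : forall s (r phi : L -> R), (forall x, s x i = r x * cos (phi x)) ->
  (forall x, s x j = r x * sin (phi x)) ->
  f s = (r x0 * r y0) ^+ m * cos (m%:R * (phi x0 - phi y0)).

Let Rm (s : spins) := (plane_norm s x0 * plane_norm s y0) ^+ m.

Let bRm : spin_bm Rm.
Proof. by apply: bmX; apply: bmM; exact: bm_plane_norm. Qed.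

(** For fixed [v] only the angles vary, and the initial angles [phi] are absorbed by translation
    invariance on the torus. The factor [XYcos] does not depend on [v], which is what allows
    [planar_comparison] to integrate the bound. *)
Lemma planar_pointwise (v : cfgN) :
  `|tint (fun al => weight (rotv i j al v) * f (normalize (rotv i j al v)))| <=
  XYcos * tint (fun al => weight (rotv i j al v) * Rm (normalize (rotv i j al v))).
Proof.
pose s := normalize v.
have /choice[rp hrp] : forall x, exists rp : R * R,
    [/\ 0 <= rp.1, s x i = rp.1 * cos rp.2 & s x j = rp.1 * sin rp.2].
  by move=> x; have [r [phi h]] := polar_coordinates (s x i) (s x j); exists (r, phi).
pose r x := (rp x).1; pose phi x := (rp x).2.
have r0 x : 0 <= r x by have [] := hrp x.
have si x : s x i = r x * cos (phi x) by have [] := hrp x.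
have sj x : s x j = r x * sin (phi x) by have [] := hrp x.
have r1 x : r x <= 1.
  rewrite -(ler_pXn2r (n := 2))// ?nnegrE// expr1n.
  apply: le_trans (sum_normalize_le1 v x); rewrite (sum_split hij) -/s si sj.
  have -> : (r x * cos (phi x)) ^+ 2 + (r x * sin (phi x)) ^+ 2 =
    r x ^+ 2 * (cos (phi x) ^+ 2 + sin (phi x) ^+ 2) by ring.
  by rewrite cos2Dsin2 mulr1 lerDl sumr_ge0// => k _; exact: sqr_ge0.
have ri (al : cfg R L) x : rots i j al s x i = r x * cos (al x + phi x).
  by rewrite /rots eqxx si sj cosD; ring.
have rj (al : cfg R L) x : rots i j al s x j = r x * sin (al x + phi x).
  by rewrite /rots eq_sym (negbTE hij) eqxx si sj sinD; ring.
pose K x y := J' x y * (r x * r y).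
have hK x y : x != y -> `|K x y| <= J x y.
  move=> xy; rewrite /K normrM (le_trans _ (hJJ' xy))// -[leRHS]mulr1 ler_wpM2l//.
  by rewrite ger0_norm ?mulr_ge0// -[leRHS]mulr1 ler_pM.
(* Energy of the components outside the plane, which the rotation leaves alone. *)
pose C := 2^-1 * \sum_x \sum_(y | y != x) J' x y * \sum_(k | (k != i) && (k != j)) s x k * s y k.
have EN (al : cfg R L) : energyN J' (rots i j al s) =
    C + energyXY K (fun x => al x + phi x).
  rewrite /energyN /C /energyXY -mulrDr -big_split /=; congr (_ * _).
  apply: eq_bigr => x _; rewrite -big_split /=; apply: eq_bigr => y _.
  rewrite /dotp (sum_split hij) !ri !rj cosB /K.
  rewrite (eq_bigr (fun k => s x k * s y k)); first by ring.
  by move=> k /andP[ki kj]; rewrite /rots (negbTE ki) (negbTE kj).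
have hrad (al : cfg R L) x : plane_norm (rots i j al s) x = r x.
  rewrite /plane_norm ri rj.
  have -> : (r x * cos (al x + phi x)) ^+ 2 + (r x * sin (al x + phi x)) ^+ 2 =
    r x ^+ 2 * (cos (al x + phi x) ^+ 2 + sin (al x + phi x) ^+ 2) by ring.
  by rewrite cos2Dsin2 mulr1 sqrtr_sqr ger0_norm.
(* The factor common to both integrals: free of the angles and nonnegative. *)
pose M := inball v * expR C * (r x0 * r y0) ^+ m.
have M0 : 0 <= M by rewrite !mulr_ge0 ?inball_ge0 ?expR_ge0 ?exprn_ge0 ?mulr_ge0.
have bK : bm (fun th : cfg R L => expR (energyXY K th)) by apply: bm_expR; exact: bm_energyXY.
have bC : bm (fun th : cfg R L => expR (energyXY K th) * cos_diff m x0 y0 th).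
  by apply: bmM => //; exact: bm_cos_diff.
have hD := @fdom_circle R.
have -> : tint (fun al => weight (rotv i j al v) * f (normalize (rotv i j al v))) =
    M * tint (fun th => expR (energyXY K th) * cos_diff m x0 y0 th).
  rewrite -(tint_shift phi bC) => [|k th]; last by rewrite periodic_energyXY periodic_cos_diff.
  rewrite -(iintZ hD); last first.
    by apply: (bm_comp _ bC); apply: measurable_add; [exact: measurable_id|exact: measurable_cst].
  congr iint; apply/funext => al.
  rewrite /weight (inball_rotv hij) (normalize_rotv hij) -/s EN expRD (hf (ri al) (rj al)).
  by rewrite /M /cos_diff; ring.
have -> : tint (fun al => weight (rotv i j al v) * Rm (normalize (rotv i j al v))) =
    M * tint (fun th => expR (energyXY K th)).
  rewrite -(tint_shift phi bK) => [|k th]; last by rewrite periodic_energyXY.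
  rewrite -(iintZ hD); last first.
    by apply: (bm_comp _ bK); apply: measurable_add; [exact: measurable_id|exact: measurable_cst].
  congr iint; apply/funext => al.
  rewrite /weight (inball_rotv hij) (normalize_rotv hij) -/s EN expRD /Rm !hrad.
  by rewrite /M; ring.
by rewrite normrM ger0_norm// mulrCA ler_wpM2l// XYcos_bound.
Qed.

Lemma planar_comparison : `|wint f| <= XYcos * wint Rm.
Proof.
have t0 := tvol_gt0 R L.
have hD := fdom_seg R.
have bw g : spin_bm g -> bm (fun v => tint (fun al => weight (rotv i j al v) * g (normalize (rotv i j al v)))).
  move=> bg; apply: (bm_iint (@fdom_circle R) (enum L) (F := fun p =>
    weight (rotv i j p.2 p.1) * g (normalize (rotv i j p.2 p.1)))).
  by apply: (bm_comp _ (bm_wint bg)); exact: measurable_rotv.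
rewrite -(ler_pM2r t0) -[X in _ * X <= _](ger0_norm (ltW t0)) -normrM -mulrA.
have avg g (bg : spin_bm g) := ballint_average (bm_wint bg) (@planar_support_weight g).
rewrite (avg _ bf) (avg _ bRm).
rewrite -(iintZ hD); last exact: bw.
rewrite ler_norml -mulN1r -(iintZ hD); last by apply: bmZ; exact: bw.
apply/andP; split; (apply: (le_iint hD) => [||v]; [by do ?apply: bmZ; exact: bw..|]).
  by have := planar_pointwise v; rewrite ler_norml mulN1r => /andP[].
by have := planar_pointwise v; rewrite ler_norml => /andP[].
Qed.

End Plane.
End Planar.

(** * Summation over coordinate planes *)

Lemma double_sum_offdiag (R : realType) (N : nat) (g : 'I_N -> 'I_N -> R) :
  \sum_i \sum_(j | j != i) g i j = \sum_i \sum_j g i j - \sum_i g i i.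
Proof.
rewrite -sumrB; apply: eq_bigr => i _; rewrite [in RHS](bigD1 i)//=.
by rewrite addrAC subrr add0r.
Qed.

Lemma sum_cstord (R : realType) (N : nat) (c : R) : \sum_(i < N) c = N%:R * c.
Proof. by rewrite sumr_const card_ord mulr_natl. Qed.

(** A common rotation of all spins preserves their inner products, hence the energy. *)
Lemma weight_rotv_cst (R : realType) (L : finType) (N : nat) (J' : L -> L -> R)
  (i j : 'I_N) (a : R) (v : cfg R (L * 'I_N)%type) : i != j ->
  weight J' (rotv i j (fun=> a) v) = weight J' v.
Proof.
move=> ij; rewrite /weight inball_rotv// normalize_rotv//; congr (_ * expR (_ * _)).
apply: eq_bigr => z _; apply: eq_bigr => w _; congr (_ * _).
have h := cos2Dsin2 a.
set s := normalize v; rewrite /dotp (sum_split ij) [RHS](sum_split ij).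
rewrite (eq_bigr (fun k => s z k * s w k)); last first.
  by move=> k /andP[ki kj]; rewrite /rots (negbTE ki) (negbTE kj).
congr (_ + _); rewrite /rots !eqxx eq_sym (negbTE ij).
transitivity ((cos a ^+ 2 + sin a ^+ 2) * (s z i * s w i + s z j * s w j)); first by ring.
by rewrite h mul1r.
Qed.

Section NVector.
Variables (R : realType) (L : finType) (N : nat) (J J' : L -> L -> R).
Hypothesis hN : (2 <= N)%N.
Hypothesis hJJ' : forall x y : L, x != y -> `|J' x y| <= J x y.
Variables (x y : L).
Notation spins := (L -> 'I_N -> R).
Notation U := (@wint R L N J').
Notation c_ m := (XYcos J m x y).

Let Z : R := U (fun=> 1).

Lemma bms_dotp : spin_bm (fun s : spins => dotp (s x) (s y)).
Proof. by apply: bm_sum => k _; apply: bmM; exact: bm_normalize. Qed.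

Lemma gibbsNE (f : spins -> R) : gibbsN J' f = U f / Z.
Proof.
rewrite /gibbsN /Z /wint; congr (_ / _); congr iint; apply/funext => v.
by rewrite mulr1.
Qed.

Lemma wint_ge0 (f : spins -> R) : spin_bm f ->
  (forall v : cfg R (L * 'I_N)%type, 0 <= f (normalize v)) -> 0 <= U f.
Proof.
move=> bf f0; rewrite -[leLHS](mul0r (U f)) -wintZ//.
by apply: le_wint => // [|v]; [exact: bmZ|rewrite mul0r].
Qed.

Lemma Z_ge0 : 0 <= Z.
Proof. by apply: wint_ge0 => //; exact: bm_cst. Qed.

(** Ginibre's inequality with K = J bounds an absolute value by [c_ m] times a positive integral. *)
Lemma XYcos_ge0 m : 0 <= c_ m.
Proof.
have hJ a b : a != b -> `|J a b| <= J a b.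
  by move=> ab; rewrite ger0_norm// (le_trans _ (hJJ' ab)).
rewrite -(pmulr_lge0 _ (partition_XY_gt0 J)).
exact: le_trans (XYcos_bound m x y hJ).
Qed.

Lemma XYcos_le1 m : c_ m <= 1.
Proof.
rewrite /XYcos /gibbsXY ler_pdivrMr ?mul1r; last exact: partition_XY_gt0.
have bE : bm (fun th : cfg R L => expR (energyXY J th)) by apply: bm_expR; exact: bm_energyXY.
apply: (le_iint (@fdom_circle R)) => [||th]; last by rewrite -[leRHS]mulr1 ler_wpM2l ?expR_ge0 ?cos_le1.
- by apply: bmM => //; exact: bm_cos_diff.
- exact: bE.
Qed.

Let f1 (i j : 'I_N) (s : spins) := s x i * s y i + s x j * s y j.

Let bf1 i j : spin_bm (f1 i j).
Proof. by apply: bmD; apply: bmM; exact: bm_normalize. Qed.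

Lemma wint_planar_dotp (i j : 'I_N) : i != j ->
  `|U (f1 i j)| <= c_ 1 * U (fun s => 2^-1 *
     (s x i ^+ 2 + s x j ^+ 2 + (s y i ^+ 2 + s y j ^+ 2))).
Proof.
move=> ij; have h := planar_comparison hJJ' ij (m := 1) (x0 := x) (y0 := y) (bf1 i j).
apply: le_trans (h _) _.
  move=> s r phi hi hj; rewrite /f1 !hi !hj mul1r cosB; ring.
rewrite ler_wpM2l ?XYcos_ge0//; apply: le_wint => [||v].
- by apply: bmX; apply: bmM; exact: bm_plane_norm.
- by apply: bmZ; apply: bmD; apply: bmD; apply: bmX; exact: bm_normalize.
rewrite expr1 -!plane_norm_sqr.
have := sqr_ge0 (plane_norm i j (normalize v) x - plane_norm i j (normalize v) y); nra.
Qed.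

Lemma wint_dotp_bound : `|U (fun s => dotp (s x) (s y))| <= c_ 1 * Z.
Proof.
(* Each coordinate lies in 2 (N - 1) ordered pairs of distinct indices. The bounds on r_x r_y sum to
   (N - 1) (a + b), where a and b are squared lengths at most 1, so this factor cancels. *)
have N1 : 0 < 2 * (N%:R - 1) :> R by rewrite mulr_gt0// subr_gt0 ltr1n.
have bq (i j : 'I_N) : spin_bm (fun s : spins => 2^-1 *
     (s x i ^+ 2 + s x j ^+ 2 + (s y i ^+ 2 + s y j ^+ 2))).
  by apply: bmZ; apply: bmD; apply: bmD; apply: bmX; exact: bm_normalize.
have bsum (P : rel 'I_N) (g : 'I_N -> 'I_N -> spins -> R) : (forall i j, spin_bm (g i j)) ->
    forall i, spin_bm (fun s => \sum_(j | P i j) g i j s).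
  by move=> bg i; apply: bm_sum => j _; exact: bg.
rewrite -(ler_pM2l N1) -[X in X * `|_|](ger0_norm (ltW N1)) -normrM.
have <- : U (fun s => \sum_i \sum_(j | j != i) f1 i j s) =
    2 * (N%:R - 1) * U (fun s => dotp (s x) (s y)).
  rewrite -wintZ; last exact: bms_dotp.
  congr U; apply/funext => s; rewrite double_sum_offdiag /f1 /dotp.
  under eq_bigr do rewrite big_split/= sum_cstord.
  by rewrite !big_split /= sum_cstord -mulr_sumr; ring.
rewrite wint_sum; last by move=> i; apply: (bsum (fun i j => j != i) f1).
apply: le_trans (ler_norm_sum _ _ _) _.
apply: (@le_trans _ _ (\sum_i \sum_(j | j != i) c_ 1 * U (fun s => 2^-1 *
     (s x i ^+ 2 + s x j ^+ 2 + (s y i ^+ 2 + s y j ^+ 2))))).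
  apply: ler_sum => i _; rewrite wint_sum//; apply: le_trans (ler_norm_sum _ _ _) _.
  by apply: ler_sum => j ji; apply: wint_planar_dotp; rewrite eq_sym.
under eq_bigr do rewrite -mulr_sumr -wint_sum//.
rewrite -mulr_sumr -wint_sum; last first.
  by move=> i; apply: (bsum (fun i j => j != i) (fun i j s => 2^-1 *
     (s x i ^+ 2 + s x j ^+ 2 + (s y i ^+ 2 + s y j ^+ 2)))).
rewrite mulrCA ler_wpM2l ?XYcos_ge0// -wintZ; last exact: bm_cst.
apply: le_wint => [||v].
- by apply: bm_sum => i _; apply: bm_sum => j _; exact: bq.
- by apply: bm_cst.
rewrite double_sum_offdiag.
set a := \sum_k normalize v x k ^+ 2; set b := \sum_k normalize v y k ^+ 2.
have -> : \sum_i \sum_j 2^-1 * (normalize v x i ^+ 2 + normalize v x j ^+ 2 +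
    (normalize v y i ^+ 2 + normalize v y j ^+ 2)) = N%:R * (a + b).
  under eq_bigr do rewrite -mulr_sumr !big_split/= !sum_cstord.
  rewrite -mulr_sumr !big_split /= !sum_cstord -!mulr_sumr -/a -/b; lra.
have -> : \sum_i 2^-1 * (normalize v x i ^+ 2 + normalize v x i ^+ 2 +
    (normalize v y i ^+ 2 + normalize v y i ^+ 2)) = a + b.
  by rewrite -mulr_sumr !big_split /= -/a -/b; lra.
have a1 : a <= 1 by exact: sum_normalize_le1.
have b1 : b <= 1 by exact: sum_normalize_le1.
have -> : N%:R * (a + b) - (a + b) = (N%:R - 1) * (a + b) by ring.
rewrite mulr1 [2 * _]mulrC ler_wpM2l; lra.
Qed.

Let sqsum (s : spins) := \sum_k (s x k * s y k) ^+ 2.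
(** Stands for the constant 1 of unit spins, in the quartic form that the sum of [rad4] over planes
    produces. *)
Let prodsq (s : spins) := (\sum_k s x k ^+ 2) * (\sum_k s y k ^+ 2).
Let dotsq (s : spins) := dotp (s x) (s y) ^+ 2.

Let bms_sqsum : spin_bm sqsum.
Proof. by apply: bm_sum => k _; apply: bmX; apply: bmM; exact: bm_normalize. Qed.
Let bms_prodsq : spin_bm prodsq.
Proof. by apply: bmM; apply: bm_sum => k _; apply: bmX; exact: bm_normalize. Qed.
Let bms_dotsq : spin_bm dotsq.
Proof. by apply: bmX; exact: bms_dotp. Qed.

Let cross (i j : 'I_N) (s : spins) := s x i * s x j * s y i * s y j.
Let diag (i j : 'I_N) (s : spins) := (s x i * s y i) ^+ 2 + (s x j * s y j) ^+ 2.
Let rad4 (i j : 'I_N) (s : spins) := (s x i ^+ 2 + s x j ^+ 2) * (s y i ^+ 2 + s y j ^+ 2).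
(** Cartesian form of r_x^2 r_y^2 cos 2 (phi_x - phi_y): the first product comes from the cosines of
    2 phi_x and 2 phi_y, the term in [cross] from their sines. *)
Let f2 (i j : 'I_N) (s : spins) :=
  (s x i ^+ 2 - s x j ^+ 2) * (s y i ^+ 2 - s y j ^+ 2) + 4 * cross i j s.

Let bcross i j : spin_bm (cross i j).
Proof. do 2 (apply: bmM; last exact: bm_normalize); apply: bmM; exact: bm_normalize. Qed.
Let bdiag i j : spin_bm (diag i j).
Proof. by apply: bmD; apply: bmX; apply: bmM; exact: bm_normalize. Qed.
Let brad4 i j : spin_bm (rad4 i j).
Proof. by apply: bmM; apply: bmD; apply: bmX; exact: bm_normalize. Qed.
Let bf2 i j : spin_bm (f2 i j).
Proof.
apply: bmD; last by apply: bmZ; exact: bcross.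
by apply: bmM; apply: bmB; apply: bmX; exact: bm_normalize.
Qed.

Lemma wint_planar_cos2 (i j : 'I_N) : i != j -> U (f2 i j) <= c_ 2 * U (rad4 i j).
Proof.
move=> ij; have h := planar_comparison hJJ' ij (m := 2) (x0 := x) (y0 := y) (bf2 i j).
apply: le_trans (ler_norm _) _; apply: le_trans (h _) _.
  move=> s r phi hi hj; rewrite /f2 /cross !hi !hj.
  have -> : 2%:R * (phi x - phi y) = (phi x - phi y) + (phi x - phi y) by ring.
  by rewrite cosD sinB cosB; ring.
rewrite le_eqVlt; apply/orP; left; apply/eqP; congr (_ * U _).
by apply/funext => s; rewrite exprMn !plane_norm_sqr.
Qed.

(* The quarter-of-pi rotation in the plane (i, j), applied to all spins at once. *)
Lemma wint_eighth_turn (i j : 'I_N) : i != j ->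
  U (diag i j) = 2^-1 * U (rad4 i j) + 2 * U (cross i j).
Proof.
move=> ij; rewrite -!wintZ//.
rewrite -wintD; [|by apply: bmZ; exact: brad4|by apply: bmZ; exact: bcross].
pose al : cfg R L := fun=> pi / 4.
have cs : sin (pi / 4) = cos (pi / 4) :> R.
  rewrite -cosBpihalf -cosN; congr cos; lra.
have c2 : cos (pi / 4) ^+ 2 = 2^-1 :> R by have := cos2Dsin2 (pi / 4 : R); rewrite cs; lra.
rewrite (wint_rots J' ij al (bdiag i j)); congr iint; apply/funext => v.
rewrite weight_rotv_cst//; congr (_ * _); rewrite /diag /rad4 /cross /rots.
rewrite eqxx eq_sym (negbTE ij) eqxx /al cs.
set c := cos _ in c2 *; set s := normalize v.
(* At each site the mixed product 2 s_i s_j enters the two squares with opposite signs, so only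
   multiples of [rad4] and [cross] survive. *)
transitivity ((c ^+ 2) ^+ 2 * (((s x i - s x j) * (s y i - s y j)) ^+ 2 +
  ((s x i + s x j) * (s y i + s y j)) ^+ 2)); first by ring.
by rewrite c2; field.
Qed.

Let S := U sqsum.
Let E := U prodsq.
Let A := U dotsq.

Lemma wint_double_sum (g : 'I_N -> 'I_N -> spins -> R) : (forall i j, spin_bm (g i j)) ->
  \sum_i \sum_(j | j != i) U (g i j) = U (fun s => \sum_i \sum_(j | j != i) g i j s).
Proof.
move=> bg; rewrite wint_sum; last by move=> i; apply: bm_sum => j _; exact: bg.
by apply: eq_bigr => i _; rewrite wint_sum.
Qed.

Lemma sum_diag (s : spins) :
  \sum_i \sum_(j | j != i) diag i j s = (2 * N%:R - 2) * sqsum s.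
Proof.
rewrite double_sum_offdiag /diag.
under eq_bigr do rewrite big_split/= sum_cstord.
by rewrite !big_split /= sum_cstord -mulr_sumr /sqsum; ring.
Qed.

Lemma sum_rad4 (s : spins) :
  \sum_i \sum_(j | j != i) rad4 i j s = (2 * N%:R - 4) * sqsum s + 2 * prodsq s.
Proof.
rewrite double_sum_offdiag /rad4.
have -> : \sum_i \sum_j (s x i ^+ 2 + s x j ^+ 2) * (s y i ^+ 2 + s y j ^+ 2) =
    2 * N%:R * sqsum s + 2 * prodsq s.
  rewrite (eq_bigr (fun i => N%:R * (s x i * s y i) ^+ 2 + sqsum s +
    (s x i ^+ 2 * (\sum_k s y k ^+ 2) + (\sum_k s x k ^+ 2) * s y i ^+ 2))).
    rewrite !big_split /= sum_cstord -mulr_sumr -mulr_suml -mulr_sumr /sqsum /prodsq.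
    by ring.
  move=> i _; rewrite mulr_sumr mulr_suml -sum_cstord /sqsum -!big_split /=.
  by apply: eq_bigr => j _; ring.
rewrite (eq_bigr (fun i => 4 * (s x i * s y i) ^+ 2)); last by move=> i _; ring.
by rewrite -mulr_sumr /sqsum; ring.
Qed.

Lemma sum_cross (s : spins) :
  \sum_i \sum_(j | j != i) cross i j s = dotsq s - sqsum s.
Proof.
rewrite double_sum_offdiag /cross /dotsq /dotp expr2 big_distrlr /=; congr (_ - _).
  by apply: eq_bigr => i _; apply: eq_bigr => j _; ring.
by apply: eq_bigr => i _; ring.
Qed.

Lemma sum_f2 (s : spins) :
  \sum_i \sum_(j | j != i) f2 i j s =
  (2 * N%:R - 4) * sqsum s - 2 * prodsq s + 4 * dotsq s.
Proof.
transitivity (\sum_i \sum_(j | j != i) (2 * diag i j s - rad4 i j s + 4 * cross i j s)).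
  by apply: eq_bigr => i _; apply: eq_bigr => j _; rewrite /f2 /diag /rad4; ring.
transitivity (2 * (\sum_i \sum_(j | j != i) diag i j s) -
   \sum_i \sum_(j | j != i) rad4 i j s + 4 * \sum_i \sum_(j | j != i) cross i j s).
  rewrite !mulr_sumr -sumrB -big_split /=; apply: eq_bigr => i _.
  by rewrite !mulr_sumr -sumrB -big_split.
by rewrite sum_diag sum_rad4 sum_cross; ring.
Qed.

Lemma wint_lin2 (a b : R) (f g : spins -> R) : spin_bm f -> spin_bm g ->
  U (fun s => a * f s + b * g s) = a * U f + b * U g.
Proof. by move=> bf bg; rewrite wintD ?wintZ//; exact: bmZ. Qed.

Lemma wint_lin3 (a b c : R) (f g h : spins -> R) : spin_bm f -> spin_bm g -> spin_bm h ->
  U (fun s => a * f s + b * g s + c * h s) = a * U f + b * U g + c * U h.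
Proof.
move=> bf bg bh; rewrite wintD ?wintZ ?wint_lin2//; last exact: bmZ.
by apply: bmD; exact: bmZ.
Qed.

(** Summed over ordered pairs, the identity of [wint_eighth_turn] reads (2 N - 2) S = (N - 2) S + E
    + 2 (A - S). *)
Lemma wint_isotropy : (N%:R + 2) * S = E + 2 * A.
Proof.
have h : \sum_i \sum_(j | j != i) U (diag i j) = \sum_i \sum_(j | j != i)
    (2^-1 * U (rad4 i j) + 2 * U (cross i j)).
  by apply: eq_bigr => i _; apply: eq_bigr => j ji; apply: wint_eighth_turn; rewrite eq_sym.
have h' : \sum_i \sum_(j | j != i) (2^-1 * U (rad4 i j) + 2 * U (cross i j)) =
    2^-1 * (\sum_i \sum_(j | j != i) U (rad4 i j)) +
    2 * (\sum_i \sum_(j | j != i) U (cross i j)).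
  rewrite !mulr_sumr -big_split /=; apply: eq_bigr => i _.
  by rewrite !mulr_sumr -big_split.
rewrite h' !wint_double_sum// in h.
rewrite (_ : (fun s => \sum_i \sum_(j | j != i) diag i j s) =
  fun s => (2 * N%:R - 2) * sqsum s) in h; last by apply/funext => s; exact: sum_diag.
rewrite (_ : (fun s => \sum_i \sum_(j | j != i) rad4 i j s) =
  fun s => (2 * N%:R - 4) * sqsum s + 2 * prodsq s) in h; last by apply/funext => s; exact: sum_rad4.
rewrite (_ : (fun s => \sum_i \sum_(j | j != i) cross i j s) =
  fun s => 1 * dotsq s + (-1) * sqsum s) in h; last first.
  by apply/funext => s; rewrite sum_cross; ring.
by rewrite !wint_lin2// wintZ// -/S -/E -/A in h; lra.
Qed.

Lemma wint_planar_cos2_sum :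
  (2 * N%:R - 4) * S - 2 * E + 4 * A <= c_ 2 * ((2 * N%:R - 4) * S + 2 * E).
Proof.
have -> : (2 * N%:R - 4) * S - 2 * E + 4 * A = \sum_i \sum_(j | j != i) U (f2 i j).
  rewrite wint_double_sum// (_ : (fun s => \sum_i \sum_(j | j != i) f2 i j s) =
    fun s => (2 * N%:R - 4) * sqsum s + (-2) * prodsq s + 4 * dotsq s).
    by rewrite wint_lin3// -/S -/E -/A; ring.
  by apply/funext => s; rewrite sum_f2; ring.
have -> : (2 * N%:R - 4) * S + 2 * E = \sum_i \sum_(j | j != i) U (rad4 i j).
  rewrite wint_double_sum// (_ : (fun s => \sum_i \sum_(j | j != i) rad4 i j s) =
    fun s => (2 * N%:R - 4) * sqsum s + 2 * prodsq s) ?wint_lin2//.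
  by apply/funext => s; exact: sum_rad4.
rewrite mulr_sumr; apply: ler_sum => i _; rewrite mulr_sumr; apply: ler_sum => j ji.
by apply: wint_planar_cos2; rewrite eq_sym.
Qed.

(* An inequality only: normalize maps the zero vector to 0. *)
Lemma wint_prodsq_le : E <= Z.
Proof.
apply: le_wint => //; first exact: bm_cst.
move=> v; have a1 := sum_normalize_le1 v x; have b1 := sum_normalize_le1 v y.
rewrite /prodsq -[leRHS]mulr1; apply: ler_pM => //.
  by apply: sumr_ge0 => k _; exact: sqr_ge0.
by apply: sumr_ge0 => k _; exact: sqr_ge0.
Qed.

Lemma wint_dotsq_bound :
  A * (2 * N%:R - (N%:R - 2) * c_ 2) <= (2 + N%:R * c_ 2) * Z.
Proof.
have g0 := XYcos_ge0 2; have N0 : 0 <= N%:R :> R by [].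
(* The planar estimates are homogeneous, with [E] in the role of 1; passing to [Z] is allowed
   because 2 + N c_2 is nonnegative. *)
apply: (@le_trans _ _ ((2 + N%:R * c_ 2) * E)); last first.
  rewrite ler_wpM2l ?wint_prodsq_le//.
  by apply: addr_ge0 => //; apply: mulr_ge0.
have hS : S = (E + 2 * A) / (N%:R + 2) by rewrite -wint_isotropy mulrC mulKf// gt_eqF// ltr_wpDl.
have := wint_planar_cos2_sum; rewrite hS -subr_ge0 => h.
have N2 : 0 < N%:R + 2 :> R by rewrite ltr_wpDl.
have := mulr_ge0 (ltW N2) h.
(* Multiplying by N + 2 clears the denominator of [S]; all coefficients then share the factor 4. *)
rewrite (_ : (N%:R + 2) * _ = 4 * ((2 + N%:R * c_ 2) * E - A * (2 * N%:R - (N%:R - 2) * c_ 2))).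
  by rewrite pmulr_rge0// subr_ge0.
by field; rewrite gt_eqF.
Qed.

Lemma wint_dotsq_ge0 : 0 <= A.
Proof. by apply: wint_ge0 => // v; exact: sqr_ge0. Qed.

End NVector.

Theorem theoremC7 (R : realType) (L : finType) (N : nat) (J J' : L -> L -> R)
  (hN : (2 <= N)%N)
  (hJsym : forall x y : L, J x y = J y x)
  (hJ'sym : forall x y : L, J' x y = J' y x)
  (hJJ' : forall x y : L, x != y -> `|J' x y| <= J x y)
  (x y : L) :
  let gam := gibbsXY J (fun th => cos (2 * (th x - th y))) in
  `|@gibbsN R L N J' (fun s => dotp (s x) (s y))|
     <= gibbsXY J (fun th => cos (th x - th y)) /\
  0 <= @gibbsN R L N J' (fun s => dotp (s x) (s y) ^+ 2) /\
  @gibbsN R L N J' (fun s => dotp (s x) (s y) ^+ 2)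
     <= N%:R^-1 + (N%:R - 1) * (N%:R + 2)
                  / (N%:R * (2 * N%:R - (N%:R - 2) * gam)) * gam /\
  N%:R^-1 + (N%:R - 1) * (N%:R + 2)
                  / (N%:R * (2 * N%:R - (N%:R - 2) * gam)) * gam
     <= N%:R^-1 + (1 - N%:R^-1) * gam.
Proof.
move=> gam.
have N2 : 2 <= N%:R :> R by rewrite ler_nat.
have g0 : 0 <= gam := XYcos_ge0 hJJ' x y 2.
have g1 : gam <= 1 := XYcos_le1 J x y 2.
have Z0 := Z_ge0 N J'.
set Z := @wint R L N J' (fun=> 1) in Z0.
(* If Z = 0, the expectations are 0 because x / 0 = 0. *)
have D0 : 0 < 2 * N%:R - (N%:R - 2) * gam.
  have : (N%:R - 2) * gam <= (N%:R - 2) * 1 by apply: ler_wpM2l; lra.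
  lra.
(* The right-hand side is what [wint_dotsq_bound] gives. Over the denominator N (2 N - (N - 2) gam),
   the coefficient of gam in the numerator is (N - 1) (N + 2) - (N - 2) = N^2. *)
have bound : N%:R^-1 + (N%:R - 1) * (N%:R + 2) / (N%:R * (2 * N%:R - (N%:R - 2) * gam)) * gam =
    (2 + N%:R * gam) / (2 * N%:R - (N%:R - 2) * gam).
  by field; rewrite !gt_eqF//; lra.
have rhs0 : 0 <= (2 + N%:R * gam) / (2 * N%:R - (N%:R - 2) * gam).
  by rewrite divr_ge0 ?(ltW D0)// addr_ge0// mulr_ge0.
rewrite !gibbsNE -/Z; split; [|split; [|split]].
- have -> : gibbsXY J (fun th => cos (th x - th y)) = XYcos J 1 x y.
    by rewrite /XYcos; congr gibbsXY; apply/funext => th; rewrite mul1r.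
  rewrite normrM [X in _ * X]ger0_norm ?invr_ge0//.
  have [Z00|Z00] := eqVneq Z 0.
    by rewrite Z00 invr0 mulr0 (XYcos_ge0 hJJ').
  by rewrite ler_pdivrMr ?lt0r ?Z00// wint_dotp_bound.
- by rewrite mulr_ge0 ?invr_ge0// wint_dotsq_ge0.
- rewrite bound.
  have [Z00|Z00] := eqVneq Z 0.
    by rewrite Z00 invr0 mulr0.
  rewrite ler_pdivrMr ?lt0r ?Z00// mulrAC ler_pdivlMr//.
  exact: wint_dotsq_bound.
(* As gam >= 0, it suffices to compare its coefficients, which comes down to N + 2 <= 2 N - (N - 2)
   gam and so to gam <= 1. *)
rewrite lerD2l ler_wpM2r// ler_pdivrMr; last by rewrite mulr_gt0//; lra.
have -> : (1 - N%:R^-1) * (N%:R * (2 * N%:R - (N%:R - 2) * gam)) =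
    (N%:R - 1) * (2 * N%:R - (N%:R - 2) * gam) by field; rewrite gt_eqF//; lra.
apply: ler_wpM2l; first lra.
have : (N%:R - 2) * gam <= (N%:R - 2) * 1 by apply: ler_wpM2l; lra.
lra.
Qed.
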